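(* Let $X$ and $Y$ be Banach spaces, where $Y$ is separable and polyhedral. Assume that $T : X \to Y$ is a bounded linear operator such that $T^*(Y^* )$ contains a boundary $B$ of $X$. Then $X$ is separable and isomorphic to a polyhedral space.
   Context: All Banach spaces are real. $S_{X^*}$ denotes the unit sphere of the dual space $X^*$. A subset $B \subset S_{X^*}$ is called a boundary of $X$ if for every $x \in X$ there is $f \in B$ with $f(x) = \|x\|$. A Banach space is polyhedral if the unit ball of each of its finite-dimensional subspaces is a polytope (the convex hull of finitely many points). $T^* : Y^* \to X^*$ is the adjoint of $T$. ''Isomorphic'' means linearly homeomorphic. *)

(* Defs.v *)
From mathcomp Require Import all_boot all_order all_algebra.
From mathcomp Require Import all_classical all_reals all_analysis.

Set Implicit Arguments.
Unset Strict Implicit.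
Unset Printing Implicit Defensive.

Import Order.TTheory GRing.Theory Num.Theory.
Import numFieldNormedType.Exports.

Local Open Scope classical_set_scope.
Local Open Scope ring_scope.

Definition separable (T : topologicalType) : Prop :=
  exists2 D : set T, countable D & dense D.

(* The elements of V^* are represented as those {linear V -> R^o} that are
   continuous. *)
Definition dual (R : realType) (V : normedModType R) :
    set {linear V -> R^o} :=
  [set f | continuous f].

Definition dual_norm (R : realType) (V : normedModType R)
    (f : {linear V -> R^o}) : R :=
  sup [set `|f x| | x in [set x : V | `|x| <= 1]].

(* dual_norm is meaningful only for continuous f ([sup] is 0 on unbounded
   sets), hence the intersection with dual V. *)
Definition dual_sphere (R : realType) (V : normedModType R) :
    set {linear V -> R^o} :=
  @dual R V `&` [set f | dual_norm f = 1].

Definition boundary (R : realType) (V : normedModType R)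
    (B : set {linear V -> R^o}) : Prop :=
  B `<=` @dual_sphere R V /\
  forall x : V, exists2 f : {linear V -> R^o}, B f & f x = `|x|.

Definition adjoint (R : realType) (V W : normedModType R)
    (T : {linear V -> W}) (g : {linear W -> R^o}) : {linear V -> R^o} :=
  g \o T.

Definition convex_hull (R : realType) (V : lmodType R) (A : set V) : set V :=
  smallest (@convex_set R V) A.

Definition polytope (R : realType) (V : lmodType R) (P : set V) : Prop :=
  exists2 A : set V, finite_set A & P = convex_hull A.

Definition linear_span (R : realType) (V : lmodType R) (n : nat)
    (e : 'I_n -> V) : set V :=
  [set \sum_(i < n) c i *: e i | c in [set: 'I_n -> R]].

Definition finite_dim_subspace (R : realType) (V : lmodType R)
    (F : set V) : Prop :=
  exists (n : nat) (e : 'I_n -> V), F = linear_span e.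

Definition polyhedral (R : realType) (V : normedModType R) : Prop :=
  forall F : set V, finite_dim_subspace F ->
    polytope (F `&` [set x : V | `|x| <= 1]).

Definition isomorphic (R : realType) (V W : normedModType R) : Prop :=
  exists (f : {linear V -> W}) (g : {linear W -> V}),
    [/\ continuous f, continuous g, cancel f g & cancel g f].

(* Main.v *)
From HB Require Import structures.
Require Import Defs.
From mathcomp Require Import all_boot all_order all_algebra.
From mathcomp Require Import all_classical all_reals all_analysis.
From mathcomp Require Import lra ring.

Import Order.TTheory GRing.Theory Num.Theory.
Import numFieldNormedType.Exports.

Local Open Scope classical_set_scope.
Local Open Scope ring_scope.
Set Implicit Arguments.
Unset Strict Implicit.
Unset Printing Implicit Defensive.

(** The new norm on X is a supremum of seminorms p_l that is locally finite:
near each nonzero point only finitely many p_l matter.  This is forced by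
p_l <= C |x|, limsup_l p_l(x) <= |x| and, for x <> 0, |x| < p_l(x) for some l
([locally_finite], [supnorm_locally_max]).  If in addition every p_l is, on
each finite-dimensional subspace F, a maximum of finitely many linear
functionals, then compactness of the sphere of F makes the supremum such a
maximum too ([supnorm_finitely_normed]), and its unit ball in F is the convex
hull of its finitely many vertices ([finitely_normed_polytope]).

The seminorms are
  p_l(x) = (1 + 1/(l+1)) (max_(d in K_l) |d(Tx)| + 4 D_l(Tx)).
Here K_l is a finite set of functionals d on Y with |d(Tx)| <= |x|.  With
(y_k) dense in Y, D_l is the largest seminorm below the norm of Y that is at
most 1/(l+1) on y_0, ..., y_(l-1); it tends to 0 pointwise, whence the bound on
the limsup.  For the lower bound, let b in B satisfy b(x) = |x|, and write
b(x) = g(Tx).  Suppose that Y^* is covered by countably many balls of radius 2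
and that K_l is a net, with respect to the values at y_0, ..., y_(l-1), of the
admissible functionals in the l-th ball.  If g lies in the l-th ball, some d in
K_l satisfies g - d <= 4 D_l, so that |x| <= |d(Tx)| + 4 D_l(Tx) < p_l(x) when
x <> 0.  That D_l is a finite maximum on finite-dimensional subspaces is where
the polyhedrality of Y enters directly ([polyhedral_damped_norm]).

It remains to cover Y^*.  Choose for each y_k a functional f_k of norm at most 1
with f_k(y_k) = |y_k|.  In a polyhedral space the norm is affine on a short
segment issued from a given point x in any direction; by Baire's theorem the
same length works for a ball of directions, so some y_k is the midpoint of
such a segment, and then f_k(x) = |x| ([dense_norming_boundary]).  Hence the
seminorms (1 + 1/(k+1)) |f_k| are locally finite as well.  Given g in Y^*,
Ekeland's variational principle on the unit ball of their supremum yields a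
point which is either 0 or one around which that supremum depends on
f_0, ..., f_(L-1) only, so that g(h) <= |h| when these vanish at h; then g is at distance at most 1 from the
span of the f_k, and at distance at most 2 from a rational combination
([dual_cover]).

Separability of X uses the same principle.  Around a nonzero point z, the new
norm grows by at most a multiple of |Th| when z is moved by h.  If the d_n lie in
the new unit ball, their images being dense in the image of that ball, but do
not span a dense subspace, apply the principle to the distance to their span:
moving z away from a d_n with T d_n close to T z increases the distance
without really increasing the norm, which is absurd ([seq_span_dist0]). *)

(** * Elementary inequalities and continuity *)

Section RealInequalities.
Variable R : realType.
Implicit Types a b c d e : R.

Lemma le_of_gap a b c d : a <= d + (b - d) / 4 + (b - d) / 4 -> d < b ->
  b <= c + (b - d) / 4 -> a <= c.
Proof. lra. Qed.

Lemma sup_half a b c : a < b -> b - (b - a) / 2 < c -> b <= 2 * c - a.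
Proof. lra. Qed.

Lemma lt_of_squeeze a b c d e : a + d <= b -> b <= c -> c - e < a -> d < e.
Proof. lra. Qed.

Lemma le_double_sub a : a <= 2 * a - a.
Proof. lra. Qed.

Lemma le_of_sup_tail a b c d e :
  a <= 2 * b - c -> d - e < c -> b <= d -> a <= d + e.
Proof. lra. Qed.

Lemma le_of_two_steps a b c d e :
  b <= d -> d * 2 <= e -> c <= a + b + d -> c <= a + e.
Proof. lra. Qed.

Lemma eq_of_le_add a b c d :
  a <= b -> c <= d -> a + c = b + d -> a = b /\ c = d.
Proof. by move=> ab cd abcd; split; lra. Qed.

Lemma convex_comb_le1 t a b :
  0 < t -> t < 1 -> a <= 1 -> b <= 1 ->
  t * a + (1 - t) * b <= 1 /\ (t * a + (1 - t) * b = 1 -> a = 1 /\ b = 1).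
Proof.
move=> t0 t1 a1 b1; split; first by nra.
by move=> h; split; nra.
Qed.

Lemma growth_contradiction (r0 r s e sg : R) :
  0 < s -> sg = s / 2 -> e = r / 10 -> r <= r0 -> 0 < r ->
  (1 + s) * r0 <= (1 + sg) * r0 + e * (2 * s + sg) -> False.
Proof. by move=> s0 -> -> rr r00; nra. Qed.

End RealInequalities.

Lemma abs_homogeneous (R : realType) (V : lmodType R) (q : V -> R) :
  (forall x, 0 <= q x) -> (forall a x, q (a *: x) <= `|a| * q x) ->
  forall a x, q (a *: x) = `|a| * q x.
Proof.
move=> q0 qZ a x; apply/eqP; rewrite eq_le qZ/=.
have [->|a0] := eqVneq a 0; first by rewrite normr0 mul0r q0.
have := qZ a^-1 (a *: x).
by rewrite scalerA mulVf// scale1r normfV mulrC ler_pdivlMr ?normr_gt0// mulrC.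
Qed.

Lemma lipschitz_cont (R : realType) (W U : normedModType R) (f : W -> U) (K : R) :
  (forall x y, `|f x - f y| <= K * `|x - y|) -> continuous f.
Proof.
move=> fK x; apply/cvgrPdist_le => /= e e0.
have K0 : 0 < `|K| + 1 by rewrite ltr_wpDl.
have dlt : 0 < e / (`|K| + 1) by rewrite divr_gt0.
apply/nbhs_normP; exists (e / (`|K| + 1)) => //= y /ltW xy.
apply: le_trans (fK _ _) _.
apply: (@le_trans _ _ ((`|K| + 1) * `|x - y|)).
  by apply: ler_wpM2r => //; apply: le_trans (ler_norm _) _; rewrite lerDl.
by rewrite mulrC -ler_pdivlMr.
Qed.

Lemma mx_coord_le (R : realType) (l : nat) (c : 'rV[R]_l) i : `|c 0 i| <= `|c|.
Proof.
rewrite [leRHS]/Num.norm /= mx_normrE; apply/bigmax_geP; right => /=.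
by exists (ord0, i).
Qed.

Lemma mx_norm_le_sum (R : realType) (l : nat) (c : 'rV[R]_l) : `|c| <= \sum_i `|c 0 i|.
Proof.
rewrite [leLHS]/Num.norm /= mx_normrE; apply/bigmax_leP; split=> /=.
  exact: sumr_ge0.
by move=> [i j] _ /=; rewrite (ord1 i) (bigD1 j)//= lerDl sumr_ge0.
Qed.

(** * The Hahn-Banach theorem *)

Section HahnBanach.
Variables (R : realType) (V : lmodType R).
Implicit Types (p : V -> R) (x y : V).

Definition sublinear p :=
  (forall x y, p (x + y) <= p x + p y) /\
  (forall (t : R) x, 0 <= t -> p (t *: x) = t * p x).

Lemma sublinear0 p : sublinear p -> p 0 = 0.
Proof. by case=> _ /(_ 0 0 (lexx _)); rewrite scale0r mul0r. Qed.

Lemma sublinearN p x : sublinear p -> - p (- x) <= p x.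
Proof.
move=> sp; have := sp.1 x (- x); rewrite subrr (sublinear0 sp).
by rewrite -lerBlDr sub0r.
Qed.

(** Zorn's lemma applies because the pointwise infimum of a chain of sublinear
functions is again sublinear, and finite since q(x) >= - p(- x). *)
Lemma minimal_sublinear p : sublinear p ->
  exists q, [/\ sublinear q, forall x, q x <= p x &
    forall r, sublinear r -> (forall x, r x <= q x) -> r = q].
Proof.
move=> sp.
pose T := {q : V -> R | sublinear q /\ forall x, q x <= p x}.
pose le (q r : T) := `[< forall x, sval r x <= sval q x >].
have [||||q qmax] := @Zorn T le.
- by move=> t; apply/asboolP.
- move=> r s t /asboolP rs /asboolP st; apply/asboolP => x.
  exact: le_trans (st x) (rs x).
- move=> [s sP] [t tP] /asboolP/= st /asboolP/= ts.
  apply: eq_exist; apply/funext => x; apply/eqP.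
  by rewrite eq_le st ts.
- move=> A totA.
  have [[a Aa]|A0] := pselect (exists a, A a); last first.
    exists (exist _ p (conj sp (fun x => lexx _))) => s As.
    by exfalso; apply: A0; exists s.
  pose S x := [set sval q x | q in A].
  have Sinf x : has_inf (S x).
    split; first by exists (sval a x), a.
    exists (- p (- x)) => _ [q Aq <-].
    have [sq qp] := svalP q.
    by apply: le_trans (sublinearN x sq); rewrite lerN2.
  pose m x := inf (S x).
  have mle q x : A q -> m x <= sval q x.
    by move=> Aq; apply: ge_inf; [exact: (Sinf x).2|exists q].
  have mge x c : (forall q, A q -> c <= sval q x) -> c <= m x.
    move=> h; apply: lb_le_inf; first exact: (Sinf x).1.
    by move=> _ [q Aq <-]; exact: h.
  have mP : sublinear m /\ forall x, m x <= p x.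
    split; last by move=> x; exact: le_trans (mle a x Aa) ((svalP a).2 x).
    split=> [x y|t x t0].
      rewrite -lerBlDr; apply: (mge _ _) => q Aq.
      rewrite lerBlDr -lerBlDl; apply: (mge _ _) => r Ar; rewrite lerBlDl.
      case: (totA q r Aq Ar) => /asboolP qr.
        apply: le_trans (mle r _ Ar) _; apply: le_trans ((svalP r).1.1 _ _) _.
        by rewrite lerD2r.
      apply: le_trans (mle q _ Aq) _; apply: le_trans ((svalP q).1.1 _ _) _.
      by rewrite lerD2l.
    move: t0; rewrite le_eqVlt => /predU1P[<-|t0].
      rewrite scale0r mul0r; apply/eqP; rewrite eq_le; apply/andP; split.
        by have := mle a 0 Aa; rewrite (sublinear0 (svalP a).1).
      by apply: (mge _ _) => q Aq; rewrite (sublinear0 (svalP q).1).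
    apply/eqP; rewrite eq_le; apply/andP; split.
      rewrite mulrC -ler_pdivrMr//; apply: (mge _ _) => q Aq.
      by rewrite ler_pdivrMr// mulrC -(svalP q).1.2 ?(ltW t0)//; exact: mle.
    apply: (mge _ _) => q Aq; rewrite (svalP q).1.2 ?(ltW t0)// ler_pM2l//.
    exact: mle.
  exists (exist _ m mP) => s As; apply/asboolP => x; exact: mle.
exists (sval q); split; [exact: (svalP q).1|exact: (svalP q).2|].
move=> r sr rq.
have rP : sublinear r /\ forall x, r x <= p x.
  by split=> // x; exact: le_trans (rq x) ((svalP q).2 x).
by have /(congr1 sval) := qmax (exist _ r rP) (introT (asboolP _) rq).
Qed.

(** The witness inf_(t >= 0) (p(x + t y) - t p(y)) is the largest sublinear
function below p that is at most - p(y) at - y. It shows that a minimal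
sublinear function is odd, and lets [hahn_banach_point] attain p at y. *)
Lemma sublinear_ray p y : sublinear p -> exists q,
  [/\ sublinear q, forall x, q x <= p x & q (- y) <= - p y].
Proof.
move=> sp.
pose S x := [set p (x + t *: y) - t * p y | t in [set t | 0 <= t]].
have Slb x t : 0 <= t -> - p (- x) <= p (x + t *: y) - t * p y.
  move=> t0; rewrite lerBrDr -sp.2// addrC lerBlDr.
  by have := sp.1 (x + t *: y) (- x); rewrite [x + _]addrC addrK.
have Sinf x : has_inf (S x).
  split; first by exists (p (x + 0 *: y) - 0 * p y), 0 => /=.
  by exists (- p (- x)) => _ [t /= t0 <-]; exact: Slb.
pose m x := inf (S x).
have mle x t : 0 <= t -> m x <= p (x + t *: y) - t * p y.
  by move=> t0; apply: ge_inf; [exact: (Sinf x).2|exists t].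
have mge x c : (forall t, 0 <= t -> c <= p (x + t *: y) - t * p y) -> c <= m x.
  move=> h; apply: lb_le_inf; first exact: (Sinf x).1.
  by move=> _ [t /= t0 <-]; exact: h.
exists m; split; first split.
- move=> x z; rewrite -lerBlDr; apply: (mge _ _) => t t0.
  rewrite lerBlDr -lerBlDl; apply: (mge _ _) => s s0; rewrite lerBlDl.
  apply: le_trans (mle _ (t + s) (addr_ge0 t0 s0)) _.
  rewrite scalerDl addrACA mulrDl opprD [leRHS]addrACA lerD2r.
  exact: sp.1.
- move=> t x; rewrite le_eqVlt => /predU1P[<-|t0].
    rewrite scale0r mul0r; apply/eqP; rewrite eq_le; apply/andP; split.
      by have := mle 0 0 (lexx _); rewrite scale0r addr0 mul0r subr0 (sublinear0 sp).
    by apply: (mge _ _) => s s0; rewrite add0r sp.2// subrr.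
  apply/eqP; rewrite eq_le; apply/andP; split.
    rewrite mulrC -ler_pdivrMr//; apply: (mge _ _) => s s0.
    rewrite ler_pdivrMr// mulrC mulrBr -sp.2 ?(ltW t0)// mulrA scalerDr scalerA.
    by apply: mle; rewrite mulr_ge0// ltW.
  apply: (mge _ _) => s s0.
  have -> : p (t *: x + s *: y) - s * p y = t * (p (x + (s / t) *: y) - s / t * p y).
    have e : t * (s / t) = s by rewrite mulrC divfK ?gt_eqF.
    by rewrite mulrBr -(sp.2 t) ?(ltW t0)// scalerDr scalerA [t * (s / t * _)]mulrA !e.
  by rewrite ler_pM2l//; apply: mle; rewrite divr_ge0// ltW.
- by move=> x; have := mle x 0 (lexx _); rewrite scale0r addr0 mul0r subr0.
- have := mle (- y) 1 ler01; rewrite scale1r mul1r addNr (sublinear0 sp).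
  by rewrite sub0r.
Qed.

Section mkLinear.
Variables (f : V -> R^o) (lf : linear f).
HB.instance Definition _ := GRing.isLinear.Build R V R^o *:%R f lf.
Definition linear_of : {linear V -> R^o} := f.
End mkLinear.

Lemma linearZR (f : {linear V -> R^o}) (a : R) x : f (a *: x) = a * f x :> R.
Proof. exact: linearZ. Qed.

(** A minimal sublinear function is odd, and an odd sublinear function is
linear. *)
Theorem hahn_banach p : sublinear p ->
  exists f : {linear V -> R^o}, forall x, f x <= p x.
Proof.
move=> /minimal_sublinear[q [sq qp qmin]].
have qN y : q (- y) = - q y.
  have [r [sr rq ry]] := sublinear_ray y sq.
  rewrite (qmin r sr rq) in ry; apply/eqP; rewrite eq_le ry/=.
  by rewrite lerNl; have := sublinearN y sq; rewrite lerNl.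
have qD x y : q (x + y) = q x + q y.
  apply/eqP; rewrite eq_le sq.1/= -lerN2 opprD -!qN opprD; exact: sq.1.
have lq : linear (q : V -> R^o).
  move=> t x y; rewrite qD; congr (_ + _).
  have [t0|t0] := leP 0 t; first exact: sq.2.
  by rewrite -[t]opprK scaleNr qN sq.2 ?oppr_ge0 ?(ltW t0)// scaleNr.
by exists (linear_of lq).
Qed.

Corollary hahn_banach_point p y : sublinear p ->
  exists f : {linear V -> R^o}, (forall x, f x <= p x) /\ f y = p y.
Proof.
move=> sp; have [q [sq qp qy]] := sublinear_ray y sp.
have [f fq] := hahn_banach sq; exists f.
have fp x : f x <= p x := le_trans (fq x) (qp x).
split=> //; apply/eqP; rewrite eq_le fp/=.
by have := le_trans (fq (- y)) qy; rewrite linearN lerN2.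
Qed.

End HahnBanach.

Lemma norm_sublinear (R : realType) (V : normedModType R) :
  sublinear (fun x : V => `|x|).
Proof.
split=> [x y|t x t0]; first exact: ler_normD.
by rewrite normrZ ger0_norm.
Qed.

(** * Convex hulls and finite maxima of functionals *)

Section Convexity.
Variables (R : realType) (V : lmodType R).

Lemma convex_setP (C : set V) : convex_set (C : set (convex_lmodType V)) <->
  (forall x y (t : R), C x -> C y -> 0 <= t <= 1 -> C (t *: x + (1 - t) *: y)).
Proof.
split=> [cC x y t Cx Cy t01|cC x y t].
  by have := cC x y (Itv01 (andP t01).1 (andP t01).2); rewrite !inE; exact.
rewrite !inE => Cx Cy; apply: cC => //.
by apply/andP; split; [exact: ge0|exact: le1].
Qed.

Lemma sub_convex_hull (A : set V) : A `<=` convex_hull A.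
Proof. exact: sub_gen_smallest. Qed.

Lemma convex_hull_min (A C : set V) :
  (forall x y (t : R), C x -> C y -> 0 <= t <= 1 -> C (t *: x + (1 - t) *: y)) ->
  A `<=` C -> convex_hull A `<=` C.
Proof. by move=> /convex_setP cC; exact: smallest_sub. Qed.

Lemma convex_hull_convex (A : set V) (x y : V) (t : R) :
  convex_hull A x -> convex_hull A y -> 0 <= t <= 1 ->
  convex_hull A (t *: x + (1 - t) *: y).
Proof.
move=> Ax Ay t01 C [cC AC]; apply: (convex_setP C).1 => //.
  exact: Ax.
exact: Ay.
Qed.

Definition finitely_normed (F : set V) (p : V -> R) :=
  exists (I : finType) (f : I -> {linear V -> R^o}),
    (forall i v, F v -> f i v <= p v) /\
    forall v, F v -> exists i, f i v = p v.

(** The points a_j play the part of the vertices of the unit ball of p. If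
whether a functional attains p at v is decided by the set of vertices at which
it equals 1, it is enough to keep one functional for each realizable set of
vertices, and there are finitely many such sets. *)
Lemma finitely_normed_of_contact (p : V -> R) (F : set V) (J : finType) (a : J -> V) :
  sublinear p ->
  (forall v (f g : {linear V -> R^o}), F v ->
    (forall x, f x <= p x) -> (forall x, g x <= p x) ->
    f v = p v -> (forall j, f (a j) = 1 -> g (a j) = 1) -> g v = p v) ->
  finitely_normed F p.
Proof.
move=> sp H.
pose Q (S : {set J}) (f : {linear V -> R^o}) :=
  (forall x, f x <= p x) /\ forall j, j \in S -> f (a j) = 1.
have [f0 f0p] := hahn_banach sp.
have /choice[g gP] : forall S : {set J}, exists g : {linear V -> R^o},
    (forall x, g x <= p x) /\ ((exists f, Q S f) -> Q S g).
  move=> S; have [[f fS]|nS] := pselect (exists f, Q S f).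
    by exists f; split=> //; exact: fS.1.
  by exists f0.
exists {set J}, g; split=> [S v _|v Fv]; first exact: (gP S).1.
have [f [fp fv]] := hahn_banach_point v sp.
pose S := [set j | f (a j) == 1]%SET.
exists S; apply: (H v f) => // [x|j fj]; first exact: (gP S).1.
have /(gP S).2[_] : exists f, Q S f.
  by exists f; split=> // j'; rewrite inE => /eqP.
by apply; rewrite inE fj.
Qed.

End Convexity.

(** * Norms damped at finitely many points *)

Section DampedNorm.
Variables (R : realType) (V : normedModType R) (l : nat).
Variables (z : 'I_l -> V) (rho : R).

(** [damped_norm] is the largest seminorm below the norm whose value at each z_i
is at most rho: its unit ball is the convex hull of the original ball and of the
points z_i / rho and - z_i / rho. It is written as an infimal convolution. *)
Definition damped_cost (c : 'rV[R]_l) (y : V) : R :=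
  `|y - \sum_i c 0 i *: z i| + rho * \sum_i `|c 0 i|.
Definition damped_norm (y : V) : R := inf (range (damped_cost ^~ y)).

Hypothesis rho0 : 0 < rho.

Lemma damped_cost_ge0 c y : 0 <= damped_cost c y.
Proof.
by rewrite addr_ge0// mulr_ge0 ?(ltW rho0)// sumr_ge0.
Qed.

Lemma damped_cost0 y : damped_cost 0 y = `|y|.
Proof.
rewrite /damped_cost big1 ?subr0 => [|i _]; last by rewrite mxE scale0r.
by rewrite big1 ?mulr0 ?addr0 => [//|i _]; rewrite mxE normr0.
Qed.

Lemma damped_norm_has_inf y : has_inf (range (damped_cost ^~ y)).
Proof.
split; first by exists (damped_cost 0 y), 0.
by exists 0 => _ [c _ <-]; exact: damped_cost_ge0.
Qed.

Lemma damped_norm_le c y : damped_norm y <= damped_cost c y.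
Proof. by apply: ge_inf; [exact: (damped_norm_has_inf y).2|exists c]. Qed.

(** The coefficient vector may be kept in a ball: outside of the ball of radius
|y| / rho the cost already exceeds its value |y| at the zero vector. *)
Lemma damped_norm_attained y : exists c, damped_norm y = damped_cost c y.
Proof.
pose M := `|y| / rho.
have [|||c] := @EVT_min_rV R l (damped_cost ^~ y) [set c | `|c| <= M].
- by exists 0 => /=; rewrite normr0 divr_ge0// ltW.
- apply: bounded_closed_compact.
    exists M; split; first exact: num_real.
    by move=> K MK c /= /le_trans; apply; exact: ltW.
  apply: (@closed_comp _ _ (fun c : 'rV[R]_l => `|c|) [set x | x <= M]).
    by move=> c _; exact: norm_continuous.
  exact: closed_le.
- apply: continuous_subspaceT.
  apply: (@lipschitz_cont _ _ _ _ (\sum_i (`|z i| + rho))) => c d.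
  rewrite /damped_cost.
  apply: le_trans (_ : _ <= `|(\sum_i (d 0 i - c 0 i) *: z i)| + rho * \sum_i `|c 0 i - d 0 i|) _.
    rewrite opprD addrACA; apply: le_trans (ler_normD _ _) _; apply: lerD.
      apply: le_trans (ler_dist_dist _ _) _.
      rewrite opprB addrC addrA subrK -sumrB.
      by under eq_bigr do rewrite -scalerBl.
    rewrite -mulrBr normrM (gtr0_norm rho0) ler_pM2l// -sumrB.
    apply: le_trans (ler_norm_sum _ _ _) _; apply: ler_sum => i _.
    exact: ler_dist_dist.
  rewrite mulr_suml mulr_sumr.
  apply: le_trans (lerD (ler_norm_sum _ _ _) (lexx _)) _.
  rewrite -big_split/=; apply: ler_sum => i _.
  rewrite normrZ mulrDl distrC.
  have : `|c 0 i - d 0 i| <= `|c - d|.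
    by have := mx_coord_le (c - d) i; rewrite !mxE.
  move=> h; apply: lerD; last by rewrite ler_pM2l.
  by rewrite mulrC ler_wpM2l.
rewrite inE/= => cM cmin; exists c; apply/eqP; rewrite eq_le damped_norm_le/=.
apply: lb_le_inf; first exact: (damped_norm_has_inf y).1.
move=> _ [d _ <-]; have [dM|dM] := leP `|d| M.
  by apply: cmin; rewrite inE.
have : damped_cost c y <= damped_cost 0 y.
  by apply: cmin; rewrite inE/= normr0 divr_ge0// ltW.
move/le_trans; apply.
rewrite damped_cost0 /damped_cost; apply: ler_wpDl => //; apply: ltW.
apply: lt_le_trans (_ : rho * `|d| <= _); last by rewrite ler_pM2l// mx_norm_le_sum.
by move: dM; rewrite ltr_pdivrMr// mulrC.
Qed.

Lemma damped_norm_le_norm y : damped_norm y <= `|y|.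
Proof.
by rewrite -damped_cost0; exact: damped_norm_le.
Qed.

Lemma damped_norm_ge0 y : 0 <= damped_norm y.
Proof. by have [c ->] := damped_norm_attained y; exact: damped_cost_ge0. Qed.

(** If z runs through longer and longer initial segments of a dense sequence
while rho tends to 0, this makes the damped norms tend to 0 pointwise. *)
Lemma damped_norm_le_dist y i : damped_norm y <= `|y - z i| + rho.
Proof.
have := damped_norm_le (delta_mx 0 i) y; rewrite /damped_cost.
rewrite (bigD1 i)//= mxE !eqxx scale1r big1 ?addr0; last first.
  by move=> j ji; rewrite mxE (negbTE ji) andbF scale0r.
rewrite (bigD1 i)//= mxE !eqxx normr1 big1 ?addr0 ?mulr1//.
by move=> j ji; rewrite mxE (negbTE ji) andbF normr0.
Qed.

Lemma damped_normD x y : damped_norm (x + y) <= damped_norm x + damped_norm y.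
Proof.
have [c ->] := damped_norm_attained x; have [d ->] := damped_norm_attained y.
apply: le_trans (damped_norm_le (c + d) _) _; rewrite /damped_cost addrACA -mulrDr.
apply: lerD.
  apply: le_trans (ler_normD _ _); rewrite addrACA -opprD -big_split/=.
  by under [in leLHS]eq_bigr do rewrite mxE scalerDl.
rewrite ler_pM2l// -big_split/=; apply: ler_sum => i _; rewrite mxE.
exact: ler_normD.
Qed.

Lemma damped_normZ_le a y : damped_norm (a *: y) <= `|a| * damped_norm y.
Proof.
have [c ->] := damped_norm_attained y.
apply: le_trans (damped_norm_le (a *: c) _) _; rewrite /damped_cost mulrDr -normrZ.
rewrite scalerBr scaler_sumr mulrCA [in leRHS]mulr_sumr.
under eq_bigr do rewrite mxE -scalerA.
by under [X in _ + rho * X <= _]eq_bigr do rewrite mxE normrM.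
Qed.

Lemma damped_normZ a y : damped_norm (a *: y) = `|a| * damped_norm y.
Proof. exact: (abs_homogeneous damped_norm_ge0 damped_normZ_le). Qed.

Lemma damped_norm_sublinear : sublinear damped_norm.
Proof.
by split=> [|t x t0]; [exact: damped_normD|rewrite damped_normZ ger0_norm].
Qed.

Lemma le_damped_norm (f : {linear V -> R^o}) (K : R) : 
  (forall y, f y <= K * `|y|) -> (forall i, `|f (z i)| <= K * rho) ->
  forall y, f y <= K * damped_norm y.
Proof.
move=> fK fz y; have [c ->] := damped_norm_attained y.
have {1}-> : y = (y - \sum_i c 0 i *: z i) + \sum_i c 0 i *: z i by rewrite subrK.
rewrite linearD mulrDr; apply: lerD; first exact: fK.
rewrite linear_sum mulrA mulr_sumr; apply: ler_sum => i _; rewrite linearZ/=.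
apply: le_trans (ler_norm _) _; rewrite normrM mulrC.
by rewrite ler_wpM2r.
Qed.

End DampedNorm.

(** * From finitely many functionals to a polytope *)

Section Subspace.
Variables (R : realType) (V : lmodType R).

Lemma linear_spanP n (e : 'I_n -> V) v :
  linear_span e v <-> exists c : 'I_n -> R, v = \sum_i c i *: e i.
Proof. by split=> [[c _ <-]|[c ->]]; exists c. Qed.

Lemma finite_dim_lin (F : set V) (a : R) (x y : V) :
  finite_dim_subspace F -> F x -> F y -> F (a *: x + y).
Proof.
move=> [n [e ->]] /linear_spanP[c ->] /linear_spanP[d ->]; apply/linear_spanP.
exists (fun i => a * c i + d i); rewrite scaler_sumr -big_split/=.
by apply: eq_bigr => i _; rewrite scalerDl scalerA.
Qed.

Lemma finite_dim0 (F : set V) : finite_dim_subspace F -> F 0.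
Proof.
move=> [n [e ->]]; apply/linear_spanP; exists (fun=> 0).
by rewrite big1// => i _; rewrite scale0r.
Qed.

Lemma finite_dimZ (F : set V) (a : R) (x : V) :
  finite_dim_subspace F -> F x -> F (a *: x).
Proof.
by move=> fF Fx; rewrite -[_ *: _]addr0; apply: finite_dim_lin => //; exact: finite_dim0.
Qed.

Lemma finite_dim_sum (F G : set V) :
  finite_dim_subspace F -> finite_dim_subspace G ->
  finite_dim_subspace [set v | exists x y, [/\ F x, G y & v = x + y]].
Proof.
move=> [n [e ->]] [m [g ->]].
exists (n + m)%N, (fun i : 'I_(n + m) => match fintype.split i with inl j => e j | inr k => g k end).
apply/seteqP; split=> v.
  move=> [x [y [/linear_spanP[c ->] /linear_spanP[d ->] ->]]]; apply/linear_spanP.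
  exists (fun i : 'I_(n + m) => match fintype.split i with inl j => c j | inr k => d k end).
  rewrite big_split_ord/=; congr (_ + _); apply: eq_bigr => i _.
    by rewrite (unsplitK (inl i)).
  by rewrite (unsplitK (inr i)).
move=> /linear_spanP[c ->]; rewrite big_split_ord/=.
exists (\sum_i c (lshift m i) *: e i), (\sum_i c (rshift n i) *: g i); split.
- by apply/linear_spanP; exists (fun i => c (lshift m i)).
- by apply/linear_spanP; exists (fun i => c (rshift n i)).
- by congr (_ + _); apply: eq_bigr => i _; rewrite ?(unsplitK (inl i)) ?(unsplitK (inr i)).
Qed.

(** The vertices are the points of the ball that are determined by their active
constraints; distinct vertices have distinct active sets, so there are finitely
many. A point that is not a vertex can be moved both ways along a direction
killed by its active constraints until a new constraint becomes active; it lies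
between the two end points, and induction on the number of inactive constraints
applies to them. *)
Lemma finitely_normed_polytope (F : set V) (N : V -> R) :
  finite_dim_subspace F -> finitely_normed F N ->
  (forall v, F v -> v != 0 -> 0 < N v) ->
  polytope (F `&` [set x : V | N x <= 1]).
Proof.
move=> fF [I [f [fN Nf]]] N0.
pose P x := F x /\ forall i, f i x <= 1.
have PE x : (F `&` [set x : V | N x <= 1]) x <-> P x.
  split=> [[Fx /= N1]|[Fx f1]].
    by split=> // i; exact: le_trans (fN _ _ Fx) N1.
  by split=> //=; have [i <-] := Nf _ Fx.
pose S x := [set i | f i x == 1]%SET.
pose A := [set x | P x /\
  forall d, F d -> (forall i, i \in S x -> f i d = 0) -> d = 0].
have Ainj x y : A x -> A y -> S x = S y -> x = y.
  move=> [Px Ax] [Py Ay] Sxy; apply/eqP; rewrite -subr_eq0; apply/eqP.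
  apply: Ax => [|i iS].
    by rewrite addrC -scaleN1r; apply: finite_dim_lin => //; [exact: Py.1|exact: Px.1].
  have := iS; rewrite Sxy !inE => /eqP fy; move: iS; rewrite inE => /eqP fx.
  by rewrite linearB/= fx fy subrr.
have /choice[g gP] : forall s : {set I}, exists x,
    (exists y, A y /\ S y = s) -> A x /\ S x = s.
  move=> s; have [[y yP]|n] := pselect (exists y, A y /\ S y = s); first by exists y.
  by exists 0 => h; exfalso; exact: n h.
exists A.
  apply: (@sub_finite_set _ _ (g @` [set: {set I}])).
    move=> x Ax; exists (S x) => //; have [|Ag Sg] := gP (S x); first by exists x.
    exact: Ainj.
  by apply: finite_image; exact: finite_finset.
(* moving from x in the direction d up to the first new active constraint *)
have walk x d : P x -> F d -> d != 0 -> (forall i, i \in S x -> f i d = 0) ->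
    exists2 t : R, 0 < t & P (x + t *: d) /\ (#|(~: S (x + t *: d)%R)%SET| < #|(~: S x)%SET|)%N.
  move=> [Fx fx] Fd d0 fd.
  have [i0 i0N] := Nf _ Fd.
  have i0P : 0 < f i0 d by rewrite i0N; exact: N0.
  have [j jP jmin] := @arg_minP _ R I i0 (fun i => 0 < f i d :> R)
    (fun i => (1 - f i x) / f i d : R) i0P.
  have jS : j \notin S x.
    by apply/negP => /fd fj; move: jP; rewrite fj ltxx.
  have fjx : f j x < 1 :> R by rewrite lt_neqAle fx andbT; move: jS; rewrite inE.
  exists ((1 - f j x) / f j d); first by rewrite divr_gt0// subr_gt0.
  set t := (X in X *: d).
  have t0 : 0 < t by rewrite divr_gt0// subr_gt0.
  have fE i : f i (x + t *: d) = f i x + t * f i d :> R by rewrite linearD linearZ.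
  split; first split.
  - by rewrite addrC; exact: finite_dim_lin.
  - move=> i; rewrite fE; have [di|di] := leP (f i d : R) 0.
      by apply: le_trans (fx i); rewrite gerDl mulr_ge0_le0// ltW.
    by rewrite addrC -lerBrDr -ler_pdivlMr// jmin.
  - apply: proper_card; rewrite fintype.properE; apply/andP; split.
      apply/fintype.subsetP => i; rewrite !inE; apply: contra => fi.
      rewrite fE (fd i) ?inE// mulr0 addr0//.
    apply/negP => /fintype.subsetP/(_ j); rewrite !inE fE.
    have -> : f j x + t * f j d = 1 :> R by rewrite /t divfK ?gt_eqF// addrC subrK.
    by rewrite eqxx => h; move: jS; rewrite inE => /h.
apply/seteqP; split=> [x /PE Px|].
  have [n] := ubnP #|(~: S x)%SET|.
  elim: n x Px => // n IH x Px xn.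
  have [Ax|] := pselect (forall d, F d -> (forall i, i \in S x -> f i d = 0) -> d = 0).
    by apply: sub_convex_hull.
  move=> /existsNP[d /not_implyP[Fd /not_implyP[fd /eqP d0]]].
  have [t t0 [Pt St]] := walk x d Px Fd d0 fd.
  have [|||s s0 [Ps Ss]] := walk x (- d) Px.
  - by rewrite -scaleN1r; exact: finite_dimZ.
  - by rewrite oppr_eq0.
  - by move=> i /fd; rewrite linearN => ->; rewrite oppr0.
  have -> : x = (s / (s + t)) *: (x + t *: d) + (1 - s / (s + t)) *: (x + s *: - d).
    have st0 : s + t != 0 by rewrite gt_eqF// addr_gt0.
    rewrite !scalerDr addrACA -scalerDl addrC [s / _ + _]addrC subrK scale1r.
    rewrite scalerN scalerN !scalerA -scalerBl.
    have -> : s / (s + t) * t - (1 - s / (s + t)) * s = 0 by field.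
    by rewrite scale0r add0r.
  apply: convex_hull_convex.
  - by apply: IH => //; exact: leq_trans St _.
  - by apply: IH => //; exact: leq_trans Ss _.
  - have st0 : 0 < s + t by rewrite addr_gt0.
    by rewrite divr_ge0 ?(ltW st0) ?(ltW s0)//= ler_pdivrMr// mul1r lerDl ltW.
apply: convex_hull_min => [x y t /PE[Fx fx] /PE[Fy fy] /andP[t0 t1]|x [Px _]]; last exact/PE.
apply/PE; split; first by apply: finite_dim_lin => //; exact: finite_dimZ.
move=> i; rewrite linearD !linearZ/=.
apply: (@le_trans _ _ (t * 1 + (1 - t) * 1)); last by rewrite !mulr1 addrC subrK.
by apply: lerD; apply: ler_wpM2l => //; rewrite subr_ge0.
Qed.

End Subspace.

(** * Stability of finite maxima of functionals *)

Section FinitelyNormed.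
Variables (R : realType) (V : lmodType R).
Implicit Types (F : set V) (p q : V -> R).

Lemma finitely_normed_ext F p q : (forall v, F v -> p v = q v) ->
  finitely_normed F p -> finitely_normed F q.
Proof.
move=> pq [I [f [fp pf]]]; exists I, f; split=> [i v Fv|v Fv].
  by rewrite -pq//; exact: fp.
by rewrite -pq//; exact: pf.
Qed.

Lemma finitely_normed_abs F (g : {linear V -> R^o}) :
  finitely_normed F (fun v => `|g v|).
Proof.
exists bool, (fun b => if b then g else \- g); split=> [[] v _ /=|v _].
- exact: ler_norm.
- by rewrite -normrN ler_norm.
- by have [g0|g0] := leP 0 (g v : R); [exists true; rewrite ger0_norm|exists false; rewrite ltr0_norm].
Qed.

Lemma finitely_normedD F p q : finitely_normed F p -> finitely_normed F q ->
  finitely_normed F (fun v => p v + q v).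
Proof.
move=> [I [f [fp pf]]] [J [g [gq qg]]].
exists (I * J)%type, (fun ij => f ij.1 \+ g ij.2); split=> [[i j] v Fv|v Fv] /=.
  by apply: lerD; [exact: fp|exact: gq].
have [i <-] := pf _ Fv; have [j <-] := qg _ Fv; by exists (i, j).
Qed.

Lemma finitely_normedZ F p (a : R) : 0 <= a -> finitely_normed F p ->
  finitely_normed F (fun v => a * p v).
Proof.
move=> a0 [I [f [fp pf]]].
exists I, (fun i => a \*: f i); split=> [i v Fv|v Fv] /=.
  by apply: ler_wpM2l => //; exact: fp.
by have [i <-] := pf _ Fv; exists i.
Qed.

Lemma finitely_normed_comp (W : lmodType R) (T : {linear V -> W}) F
    (G : set W) (p : W -> R) :
  (forall v, F v -> G (T v)) -> finitely_normed G p ->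
  finitely_normed F (fun v => p (T v)).
Proof.
move=> TFG [I [f [fp pf]]]; exists I, (fun i => f i \o T).
split=> [i v /TFG Gv|v /TFG Gv] /=; [exact: fp|exact: pf].
Qed.

Lemma finitely_normed_sup F (L : nat) (p : 'I_L -> V -> R) (N : V -> R) :
  (forall i, finitely_normed F (p i)) ->
  (forall i v, F v -> p i v <= N v) ->
  (forall v, F v -> exists i, N v = p i v) -> finitely_normed F N.
Proof.
move=> fp pN Np.
pose X := {I : finType & I -> {linear V -> R^o}}.
have /choice[g gP] : forall i, exists g : X,
    (forall j v, F v -> tagged g j v <= p i v) /\
    forall v, F v -> exists j, tagged g j v = p i v.
  by move=> i; have [I [f fP]] := fp i; exists (existT _ I f).
exists {i : 'I_L & tag (g i)}, (fun t => tagged (g (tag t)) (tagged t)).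
split=> [[i j] v Fv /=|v Fv].
  exact: le_trans ((gP i).1 j v Fv) (pN i v Fv).
have [i ->] := Np _ Fv; have [j <-] := (gP i).2 v Fv.
by exists (existT _ i j).
Qed.

Lemma finitely_normed_bigmax F (M : nat) (p : nat -> V -> R) :
  (forall i, finitely_normed F (p i)) ->
  finitely_normed F (fun v => \big[Num.max/0]_(i < M) p i v).
Proof.
elim: M p => [|M IH] p fp.
  exists unit, (fun=> \0); split=> [_ v _ /=|v _]; first by rewrite big_ord0.
  by exists tt; rewrite big_ord0.
pose q (i : 'I_2) v := if i == 0 then \big[Num.max/0]_(i < M) p i.+1 v else p 0%N v.
apply: (@finitely_normed_sup _ _ q).
- by move=> i; rewrite /q; case: eqP => // _; exact: (IH (fun i => p i.+1)).
- move=> i v _; rewrite /q big_ord_recl/= le_max.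
  by case: eqP => _; rewrite lexx ?orbT.
- move=> v _ /=; rewrite big_ord_recl/=; have [_|_] := leP (p 0%N v).
    by exists 0.
  by exists 1.
Qed.

End FinitelyNormed.

(** * Finite-dimensional sections of a polyhedral space *)

Section Polyhedral.
Variables (R : realType) (V : normedModType R).
Hypothesis polyV : polyhedral V.

(** On the span E of F and of the z_i the unit ball is the convex hull of a
finite set A. A functional f below the damped norm that attains it at
v = w + sum_i c_i z_i must attain the norm at w and take the value
rho * |c_i| at c_i z_i. The second condition says that f = 1 at z_i / rho or at
- z_i / rho whenever c_i <> 0; the first one says that w / |w| belongs to the
convex hull of the points of A at which f = 1. So only the points of A and the
points z_i / rho, - z_i / rho at which f = 1 matter. *)
Lemma polyhedral_damped_norm (F : set V) (l : nat) (z : 'I_l -> V) (rho : R) :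
  finite_dim_subspace F -> 0 < rho -> finitely_normed F (damped_norm z rho).
Proof.
move=> fF rho0.
pose E := [set v | exists x y, [/\ F x, linear_span z y & v = x + y]].
have fE : finite_dim_subspace E.
  by apply: finite_dim_sum => //; exists l, z.
have [A /finite_seqP[s sA] EA] := polyV fE.
pose a (j : 'I_(size s) + ('I_l + 'I_l)) : V :=
  match j with
  | inl i => nth 0 s i
  | inr (inl i) => rho^-1 *: z i
  | inr (inr i) => - (rho^-1 *: z i)
  end.
apply: (@finitely_normed_of_contact _ _ _ _ _ a) => [|v f g Fv fD gD fv fg].
  exact: damped_norm_sublinear.
have [c vc] := damped_norm_attained z rho0 v.
set w := v - \sum_i c 0 i *: z i.
have vE : v = w + \sum_i c 0 i *: z i by rewrite subrK.
have fN (h : {linear V -> R^o}) (hD : forall x, h x <= damped_norm z rho x) x : h x <= `|x|.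
  exact: le_trans (hD x) (damped_norm_le_norm z rho0 x).
have zrho i : damped_norm z rho (z i) <= rho.
  by have := damped_norm_le_dist z rho0 (z i) i; rewrite subrr normr0 add0r.
have fz (h : {linear V -> R^o}) (hD : forall x, h x <= damped_norm z rho x) i :
    `|h (z i) : R| <= rho.
  rewrite ler_norml; apply/andP; split; last exact: le_trans (hD _) (zrho i).
  rewrite lerNl -linearN; apply: le_trans (hD _) _.
  by rewrite -scaleN1r damped_normZ// normrN normr1 mul1r.
have fcz i : c 0 i * f (z i) <= rho * `|c 0 i|.
  apply: le_trans (ler_norm _) _; rewrite normrM mulrC.
  by rewrite ler_wpM2r// fz.
have fvE (h : {linear V -> R^o}) : h v = h w + \sum_i c 0 i * h (z i) :> R.
  rewrite {1}vE linearD linear_sum; congr (_ + _).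
  by apply: eq_bigr => i _; rewrite linearZ.
have [fw fs] : f w = `|w| /\ \sum_i c 0 i * f (z i) = \sum_i rho * `|c 0 i|.
  apply: eq_of_le_add; first exact: fN.
    by apply: ler_sum => i _; exact: fcz.
  by rewrite -fvE fv vc -mulr_sumr.
have {}fcz i : c 0 i * f (z i) = rho * `|c 0 i|.
  have h j : true -> 0 <= rho * `|c 0 j| - c 0 j * f (z j).
    by rewrite subr_ge0 => _; exact: fcz.
  have : \sum_j (rho * `|c 0 j| - c 0 j * f (z j)) == 0.
    by rewrite sumrB fs subrr.
  by rewrite (psumr_eq0 _ h) => /allP/(_ i (mem_index_enum i))/=; rewrite subr_eq0 => /eqP.
have gw : g w = `|w|.
  have [->|w0] := eqVneq w 0; first by rewrite linear0 normr0.
  have nw : 0 < `|w| by rewrite normr_gt0.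
  have : (E `&` [set x | `|x| <= 1]) (`|w|^-1 *: w).
    split=> /=; last by rewrite normrZ normfV normr_id mulVf ?gt_eqF.
    apply: finite_dimZ => //; exists v, (- \sum_i c 0 i *: z i); split=> //.
    apply/linear_spanP; exists (fun i => - c 0 i); rewrite -sumrN.
    by apply: eq_bigr => i _; rewrite scaleNr.
  (* convex and containing A, hence containing w / |w| *)
  pose C := [set u | f u <= 1 :> R /\ (f u = 1 :> R -> g u = 1 :> R)].
  have cC x y (t : R) : C x -> C y -> 0 <= t <= 1 -> C (t *: x + (1 - t) *: y).
    move=> [fx gx] [fy gy] /andP[]; rewrite le_eqVlt => /predU1P[<- _|t0].
      by rewrite scale0r add0r subr0 scale1r.
    rewrite le_eqVlt => /predU1P[->|t1].
      by rewrite subrr scale0r addr0 scale1r.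
    have lE (h : {linear V -> R^o}) :
      h (t *: x + (1 - t) *: y) = t * h x + (1 - t) * h y :> R.
      by rewrite linearD !linearZ.
    have [h1 h2] := convex_comb_le1 t0 t1 fx fy.
    rewrite /C /= !lE; split=> // /h2[/gx -> /gy ->].
    by rewrite !mulr1 addrC subrK.
  have AC : A `<=` C.
    move=> x Ax; split.
      have : (E `&` [set x | `|x| <= 1]) x by rewrite EA; exact: sub_convex_hull.
      by move=> [_ /= x1]; exact: le_trans (fN _ fD x) x1.
    move=> fx; move: Ax; rewrite sA/= => /(nthP 0)[i si xi].
    by have := fg (inl (Ordinal si)); rewrite /a/= xi; apply.
  rewrite EA => /(convex_hull_min cC AC)[_].
  rewrite !linearZ/= fw => h.
  have : `|w|^-1 * g w = 1 by apply: h; rewrite [LHS]mulVf ?gt_eqF.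
  by move/(congr1 ( *%R `|w|)); rewrite mulrA mulfV ?gt_eqF// mul1r mulr1.
have gcz i : c 0 i * g (z i) = rho * `|c 0 i|.
  have rV : rho^-1 * rho = 1 by rewrite mulVf ?gt_eqF.
  have [c0|c0|->] := ltgtP (c 0 i) 0; last by rewrite mul0r normr0 mulr0.
  - have fr : f (z i) = - rho.
      apply: (@mulfI _ (c 0 i)); first by rewrite lt_eqF.
      by rewrite [LHS]fcz ltr0_norm//; ring.
    have aE (h : {linear V -> R^o}) : h (a (inr (inr i))) = - (rho^-1 * h (z i)) :> R.
      by rewrite /a linearN linearZ.
    have /fg : f (a (inr (inr i))) = 1 by rewrite aE fr mulrN opprK.
    rewrite aE => gr.
    have -> : g (z i) = - rho.
      apply: (@mulfI _ (rho^-1)); first by rewrite invr_eq0 gt_eqF.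
      by rewrite mulrN rV -gr opprK.
    by rewrite ltr0_norm// !mulrN mulrC.
  - have fr : f (z i) = rho.
      apply: (@mulfI _ (c 0 i)); first by rewrite gt_eqF.
      by rewrite [LHS]fcz gtr0_norm//; ring.
    have aE (h : {linear V -> R^o}) : h (a (inr (inl i))) = rho^-1 * h (z i) :> R.
      by rewrite /a linearZ.
    have /fg : f (a (inr (inl i))) = 1 by rewrite aE fr.
    rewrite aE => gr.
    have -> : g (z i) = rho.
      apply: (@mulfI _ (rho^-1)); first by rewrite invr_eq0 gt_eqF.
      by rewrite rV -gr.
    by rewrite gtr0_norm// mulrC.
rewrite fvE gw vc /damped_cost mulr_sumr; congr (_ + _).
by apply: eq_bigr => i _; exact: gcz.
Qed.

Lemma polyhedral_norm (F : set V) :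
  finite_dim_subspace F -> finitely_normed F (fun v => `|v|).
Proof.
move=> fF; pose z (i : 'I_0) : V := 0.
apply: (finitely_normed_ext _ (polyhedral_damped_norm z fF ltr01)) => v _.
have [c ->] := damped_norm_attained z ltr01 v.
by rewrite /damped_cost !big_ord0 mulr0 subr0 addr0.
Qed.

End Polyhedral.

(** * Locally finite suprema of seminorms *)

Record locally_finite (R : realType) (V : normedModType R)
    (p : nat -> V -> R) (C : R) : Prop := LocallyFinite {
  lf_add : forall i x y, p i (x + y) <= p i x + p i y;
  lf_scale : forall i (a : R) x, p i (a *: x) = `|a| * p i x;
  lf_bound : forall i x, p i x <= C * `|x|;
  lf_limsup : forall x e, 0 < e ->
    exists L, forall i, (L <= i)%N -> p i x <= `|x| + e;
  lf_exceed : forall x, x != 0 -> exists i, `|x| < p i x }.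

Section LocallyFiniteNorm.
Variables (R : realType) (V : normedModType R) (p : nat -> V -> R) (C : R).
Hypothesis lf : locally_finite p C.

Let pD := lf_add lf.
Let pZ := lf_scale lf.
Let pC := lf_bound lf.
Let plim := lf_limsup lf.
Let pgt := lf_exceed lf.

Definition supnorm (x : V) : R := sup (range (p ^~ x)).

Lemma supnorm_has_sup x : has_sup (range (p ^~ x)).
Proof.
split; first by exists (p 0 x), 0%N.
by exists (C * `|x|) => _ [i _ <-]; exact: pC.
Qed.

Lemma le_supnorm i x : p i x <= supnorm x.
Proof. by apply: sup_upper_bound; [exact: supnorm_has_sup|exists i]. Qed.

Lemma supnorm_le x M : (forall i, p i x <= M) -> supnorm x <= M.
Proof.
by move=> pM; apply: ge_sup; [exact: (supnorm_has_sup x).1|move=> _ [i _ <-]].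
Qed.

Lemma seminorm0 i : p i 0 = 0.
Proof. by rewrite -(scale0r 0) pZ normr0 mul0r. Qed.

Lemma seminorm_ge0 i x : 0 <= p i x.
Proof.
have := pD i x (- x); rewrite subrr seminorm0.
by rewrite -scaleN1r pZ normrN normr1 mul1r -mulr2n pmulrn_lge0.
Qed.

Lemma supnorm_gt x : x != 0 -> `|x| < supnorm x.
Proof. by move=> /pgt[i /lt_le_trans]; apply; exact: le_supnorm. Qed.

Lemma supnorm0 : supnorm 0 = 0.
Proof.
apply/eqP; rewrite eq_le; apply/andP; split.
  by apply: supnorm_le => i; rewrite seminorm0.
by have := le_supnorm 0 0; rewrite seminorm0.
Qed.

Lemma norm_le_supnorm x : `|x| <= supnorm x.
Proof.
by have [->|/supnorm_gt/ltW//] := eqVneq x 0; rewrite normr0 supnorm0.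
Qed.

Lemma supnorm_le_norm x : supnorm x <= C * `|x|.
Proof. exact: supnorm_le. Qed.

Lemma supnormD x y : supnorm (x + y) <= supnorm x + supnorm y.
Proof.
apply: supnorm_le => i; apply: le_trans (pD i x y) _.
by apply: lerD; exact: le_supnorm.
Qed.

Lemma supnormZ_le a x : supnorm (a *: x) <= `|a| * supnorm x.
Proof. by apply: supnorm_le => i; rewrite pZ ler_wpM2l// le_supnorm. Qed.

Lemma supnormZ a x : supnorm (a *: x) = `|a| * supnorm x.
Proof.
apply: (abs_homogeneous _ supnormZ_le) => z.
exact: le_trans (norm_le_supnorm z).
Qed.

Lemma supnorm_eq0 x : supnorm x = 0 -> x = 0.
Proof.
move=> x0; apply/eqP; rewrite -normr_le0.
by apply: le_trans (norm_le_supnorm x) _; rewrite x0.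
Qed.

Lemma ord_argmax (L : nat) (F : nat -> R) : (0 < L)%N ->
  exists2 i, (i < L)%N & forall j, (j < L)%N -> F j <= F i.
Proof.
case: L => // L _; elim: L => [|L [i iL iP]].
  by exists 0%N => // -[].
have [FiL|FLi] := leP (F i) (F L.+1).
  exists L.+1 => // j; rewrite ltnS leq_eqVlt => /predU1P[->//|jL].
  exact: le_trans (iP j jL) FiL.
exists i; first exact: ltnW.
by move=> j; rewrite ltnS leq_eqVlt => /predU1P[->|/iP//]; exact: ltW.
Qed.

(** Let gap = p_(i0)(x) - |x| > 0. For large i the value p_i(x) stays below
p_(i0)(x) by almost gap, and p_i <= C |.| bounds the variation of all the p_i at
once, so these indices stay irrelevant around x. *)
Lemma supnorm_locally_max x : x != 0 -> exists (L : nat) (r : R), 0 < r /\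
  forall h, `|h| <= r -> exists2 i, (i < L)%N & supnorm (x + h) = p i (x + h).
Proof.
move=> x0; have [i0 i0x] := pgt x0.
pose gap := p i0 x - `|x|.
have gap0 : 0 < gap by rewrite subr_gt0.
have C1 : 0 < `|C| + 1 by rewrite ltr_wpDl.
have g40 : 0 < gap / 4 by rewrite divr_gt0.
have [L LP] := plim x g40.
exists (maxn L i0.+1), (gap / 4 / (`|C| + 1)); split; first by rewrite divr_gt0.
move=> h; rewrite ler_pdivlMr// => hr.
have pCh i k : `|k| * (`|C| + 1) <= gap / 4 -> p i k <= gap / 4.
  apply: le_trans; apply: le_trans (pC _ _) _.
  by rewrite mulrC ler_wpM2l// (le_trans (ler_norm _))// lerDl.
have far i : (L <= i)%N -> p i (x + h) <= `|x| + gap / 4 + gap / 4.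
  by move=> Li; apply: le_trans (pD _ _ _) _; apply: lerD; [exact: LP|exact: pCh].
have near0 : p i0 x <= p i0 (x + h) + gap / 4.
  have := pD i0 (x + h) (- h); rewrite addrK => /le_trans; apply.
  by rewrite lerD2l pCh// normrN.
have far' i : (L <= i)%N -> p i (x + h) <= p i0 (x + h).
  by move=> /far h1; apply: le_of_gap h1 _ near0; rewrite -subr_gt0.
have [|i iL iP] := @ord_argmax (maxn L i0.+1) (fun i => p i (x + h)).
  by rewrite leq_max orbT.
exists i => //; apply/eqP; rewrite eq_le le_supnorm andbT.
apply: supnorm_le => j; have [jL|Lj] := ltnP j (maxn L i0.+1); first exact: iP.
apply: le_trans (far' j _) _; first exact: leq_trans (leq_maxl _ _) Lj.
by apply: iP; rewrite leq_max ltnSn orbT.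
Qed.

Lemma supnorm_locally_le x : x != 0 -> exists (L : nat) (r : R), 0 < r /\
  forall h, `|h| <= r -> supnorm (x + h) <= supnorm x + \sum_(i < L) p i h.
Proof.
move=> /supnorm_locally_max[L [r [r0 rP]]]; exists L, r; split=> // h /rP[i iL ->].
apply: le_trans (pD _ _ _) _; apply: lerD; first exact: le_supnorm.
rewrite (bigD1 (Ordinal iL))//= lerDl sumr_ge0// => j _; exact: seminorm_ge0.
Qed.

Lemma supnorm_lipschitz x y : `|supnorm x - supnorm y| <= C * `|x - y|.
Proof.
have H a b : supnorm a - supnorm b <= C * `|a - b|.
  rewrite lerBlDl; apply: le_trans (_ : supnorm b + supnorm (a - b) <= _).
    by rewrite -{1}(subrK b a) addrC; exact: supnormD.
  by rewrite lerD2l supnorm_le_norm.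
rewrite ler_norml H andbT lerNl opprB; apply: le_trans (H y x) _.
by rewrite distrC.
Qed.

End LocallyFiniteNorm.

(** * Ekeland's variational principle *)

Section Ekeland.
Variables (R : realType) (V : completeNormedModType R).

(** S x is the set of improvements of x: the gain in phi has to pay for the
distance travelled. Each step of the sequence u captures half of the possible
gain, so that u is Cauchy and its limit cannot be improved. *)
Lemma ekeland (A : set V) (phi : V -> R) (K M e : R) (x1 : V) :
  closed A -> A x1 -> (forall x y, `|phi x - phi y| <= K * `|x - y|) ->
  (forall x, A x -> phi x <= M) -> 0 < e ->
  exists x0, [/\ A x0, phi x1 <= phi x0 &
    forall x, A x -> phi x <= phi x0 + e * `|x - x0|].
Proof.
move=> cA Ax1 phiK phiM e0.
pose S x := [set y | A y /\ phi x + e * `|y - x| <= phi y].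
pose m x := sup (phi @` S x).
have Sxx x : A x -> S x x by split=> //; rewrite subrr normr0 mulr0 addr0.
have Shas x : A x -> has_sup (phi @` S x).
  move=> Ax; split; first by exists (phi x), x => //; exact: Sxx.
  by exists M => _ [y [Ay _] <-]; exact: phiM.
have step x : exists y, A x -> S x y /\ m x <= 2 * phi y - phi x.
  have [Ax|nA] := pselect (A x); last by exists x.
  have phim : phi x <= m x by apply: sup_upper_bound; [exact: Shas|exists x => //; exact: Sxx].
  move: phim; rewrite le_eqVlt => /predU1P[phim|phim].
    exists x => _; split; first exact: Sxx.
    by rewrite -phim le_double_sub.
  have d0 : 0 < (m x - phi x) / 2 by rewrite divr_gt0// subr_gt0.
  have [_ [y Sy <-] my] := sup_adherent d0 (Shas x Ax).
  exists y => _; split=> //.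
  exact: sup_half phim my.
have [g gP] := choice step.
pose u n := iter n g x1.
have Au n : A (u n).
  by elim: n => //= n IH; have [[]] := gP _ IH.
have uS n : S (u n) (u n.+1) by have [] := gP _ (Au n).
have Strans x y z : S x y -> S y z -> S x z.
  move=> [Ay xy] [Az yz]; split=> //; apply: le_trans yz.
  apply: le_trans (lerD xy (lexx _)); rewrite -addrA lerD2l -mulrDr ler_pM2l//.
  by rewrite [leRHS]addrC -[z - x](subrKA y) ; exact: ler_normD.
have uSn n k : S (u n) (u (n + k)%N).
  elim: k => [|k IH]; first by rewrite addn0; exact: Sxx.
  by rewrite addnS; exact: Strans IH (uS _).
have phiu n k : phi (u n) <= phi (u (n + k)%N).
  by have [_] := uSn n k; apply: le_trans; rewrite lerDl mulr_ge0// ltW.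
have phiuhas : has_sup (range (phi \o u)).
  split; first by exists (phi (u 0%N)), 0%N.
  by exists M => _ [n _ <-]; exact: phiM.
pose s := sup (range (phi \o u)).
have phis n : phi (u n) <= s by apply: sup_upper_bound => //; exists n.
have tail (d : R) : 0 < d -> exists N, forall n, (N <= n)%N -> s - d < phi (u n).
  move=> d0; have [_ [N _ <-] sN] := sup_adherent d0 phiuhas.
  by exists N => n /subnKC <-; exact: lt_le_trans sN (phiu _ _).
have cauchyu : cauchy (u @ \oo).
  apply/cauchyP => d d0 /=.
  have [|N NP] := tail (e * d); first exact: mulr_gt0.
  exists (u N); near=> n.
  have Nn : (N <= n)%N by near: n; exact: nbhs_infty_ge.
  rewrite -ball_normE /= distrC.
  have [_] := uSn N (n - N)%N; rewrite subnKC// => h.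
  rewrite -(ltr_pM2l e0); exact: lt_of_squeeze h (phis n) (NP N (leqnn _)).
have cvu : cvg (u @ \oo) by exact: cauchy_cvg.
pose x0 := lim (u @ \oo).
have phic : continuous phi by exact: lipschitz_cont phiK.
have Sclosed x : closed (S x).
  have -> : S x = A `&` [set y | phi x <= phi y - e * `|y - x|].
    by apply/seteqP; split=> y [Ay h]; split=> //=; move: h => /=; rewrite lerBrDr.
  apply: closedI => //.
  apply: (@closed_comp _ _ (fun y => phi y - e * `|y - x|) [set t | phi x <= t]).
    move=> y _; apply: cvgB; first exact: phic.
    apply: cvgMr; apply: cvg_norm; apply: cvgB; [exact: cvg_id|exact: cvg_cst].
  exact: closed_ge.
have Sx0 n : S (u n) x0.
  apply: (closed_cvg (S (u n))) cvu; first exact: Sclosed.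
  near=> k; have nk : (n <= k)%N by near: k; exact: nbhs_infty_ge.
  by have := uSn n (k - n)%N; rewrite subnKC.
have [Ax0 x10] := Sx0 0%N.
exists x0; split=> //.
  by apply: le_trans x10; rewrite lerDl mulr_ge0// ltW.
move=> x Ax; rewrite leNgt; apply/negP => xx0.
have Sx n : S (u n) x by apply: Strans (Sx0 n) _; split=> //; exact: ltW.
have phix0 n : phi x <= 2 * phi (u n.+1) - phi (u n).
  have [_] := gP _ (Au n); apply: le_trans.
  by apply: sup_upper_bound; [exact: Shas|exists x].
have phixs : phi x <= s.
  apply/ler_addgt0Pr => d d0; have [N NP] := tail d d0.
  exact: le_of_sup_tail (phix0 N) (NP N (leqnn _)) (phis N.+1).
have sphi : s <= phi x0.
  apply: ge_sup; first exact: phiuhas.1.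
  move=> _ [n _ <-] /=; have [_] := Sx0 n; apply: le_trans.
  by rewrite lerDl mulr_ge0// ltW.
have := lt_le_trans xx0 (le_trans phixs sphi).
by rewrite gtrDl ltNge mulr_ge0// ltW.
Unshelve. all: by end_near. Qed.

End Ekeland.

(** * A countable family of functionals attaining the norm *)

Lemma baire_cover (R : realType) (V : completeNormedModType R) (W : nat -> set V) :
  (forall n, closed (W n)) -> (forall x, exists n, W n x) ->
  exists n w (r : R), 0 < r /\ forall x, `|w - x| < r -> W n x.
Proof.
move=> cW covW; apply: contrapT => nW.
have odW n : open (~` W n) /\ dense (~` W n).
  split; first exact: closed_openC.
  move=> O [w Ow] oO; apply: contrapT => OW; apply: nW; exists n, w.
  have /nbhs_normP[r r0 rO] : \forall x \near w, O x by exact: open_nbhs_nbhs.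
  exists r; split=> // x /rO Ox; apply: contrapT => nWx.
  by apply: OW; exists x.
have [||x [_ xW]] := @Baire _ V _ odW setT.
- by exists 0.
- exact: openT.
- by have [n Wx] := covW x; exact: (xW n I).
Qed.

Lemma separable_dense_seq (R : realType) (V : normedModType R) : separable V ->
  exists y : nat -> V, forall x (e : R), 0 < e -> exists i, `|x - y i| < e.
Proof.
move=> [D /countable_injP[f injf] dD].
have /choice[y yP] : forall n, exists x, (exists2 x', D x' & f x' = n) -> D x /\ f x = n.
  move=> n; have [[x Dx fx]|h] := pselect (exists2 x', D x' & f x' = n).
    by exists x.
  by exists 0 => /h.
exists y => x e e0.
have [||z [xz Dz]] := dD (ball x e).
- by exists x; exact: ballxx.
- exact: ball_open.
exists (f z); have [|Dy fy] := yP (f z); first by exists z.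
move/injf : fy => ->; rewrite ?inE//.
by move: xz; rewrite -ball_normE.
Qed.

Section DenseNorming.
Variables (R : realType) (Y : completeNormedModType R).
Hypothesis polyY : polyhedral Y.

Lemma pigeonhole (I : finType) (i : nat -> I) :
  exists j, forall N, exists2 k, (N <= k)%N & i k = j.
Proof.
apply: contrapT => h.
have /choice[N NP] : forall j, exists N, forall k, (N <= k)%N -> i k <> j.
  move=> j; apply: contrapT => hj; apply: h; exists j => N.
  apply: contrapT => hN; apply: hj; exists N => k Nk ik; apply: hN.
  by exists k.
pose M := \max_(j : I) N j.
exact: (NP (i M) M (leq_bigmax _)) erefl.
Qed.

(** Among finitely many functionals that compute the norm on the span of x and
w, one attains it at x + w / (k+1) for infinitely many k, hence also at x, and
hence at the sum of the two points. *)
Lemma polyhedral_segment (x w : Y) : exists n : nat,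
  `|2 *: x + n.+1%:R^-1 *: w| = `|x| + `|x + n.+1%:R^-1 *: w|.
Proof.
pose e (i : 'I_2) : Y := if i == 0 then x else w.
have fF : finite_dim_subspace (linear_span e) by exists 2%N, e.
have Fx a b : linear_span e (a *: x + b *: w).
  apply/linear_spanP; exists (fun i : 'I_2 => if i == 0 then a else b).
  by rewrite !big_ord_recl big_ord0 addr0.
have Fx1 b : linear_span e (x + b *: w) by rewrite -[x]scale1r.
have [J [g [gN Ng]]] := polyhedral_norm polyY fF.
have /choice[i iP] : forall k : nat, exists i,
    g i (x + k.+1%:R^-1 *: w) = `|x + k.+1%:R^-1 *: w| by move=> k; exact: Ng.
have [j jP] := pigeonhole i.
have gx : g j x = `|x|.
  apply/eqP; rewrite eq_le; apply/andP; split.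
    by apply: gN; have := Fx1 0; rewrite scale0r addr0.
  apply/ler_addgt0Pr => d d0.
  have [k kN ik] := jP (Num.truncn (`|w| * 2 / d)).
  have gw : g j (k.+1%:R^-1 *: w) <= `|k.+1%:R^-1 *: w|.
    by apply: gN; have := Fx 0 k.+1%:R^-1; rewrite scale0r add0r.
  have := iP k; rewrite ik linearD => gk.
  have nw : `|k.+1%:R^-1 *: w| * 2 <= d.
    rewrite normrZ gtr0_norm ?invr_gt0// -mulrA ler_pdivrMl// -ler_pdivrMr//.
    have /ltW/le_trans := truncnS_gt (`|w| * 2 / d); apply.
    by rewrite ler_nat ltnS.
  have : `|x| <= `|x + k.+1%:R^-1 *: w| + `|k.+1%:R^-1 *: w|.
    by rewrite -{1}(addrK (k.+1%:R^-1 *: w) x) -[X in _ <= _ + X]normrN ler_normD.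
  rewrite -gk; move: gw nw.
  move: (g j x : R) (g j (k.+1%:R^-1 *: w) : R) `|x| `|k.+1%:R^-1 *: w|.
  by move=> u1 u2 u3 u4; exact: le_of_two_steps.
have [k _ ik] := jP 0%N; exists k.
have gk := iP k; rewrite ik in gk.
have E : 2 *: x + k.+1%:R^-1 *: w = x + (x + k.+1%:R^-1 *: w).
  by rewrite scaler_nat mulr2n addrA.
apply/eqP; rewrite eq_le {1}E ler_normD/= -gx -gk -linearD -E.
by apply: gN; exact: Fx.
Qed.

Variables (y : nat -> Y) (f : nat -> {linear Y -> R^o}).
Hypothesis y_dense : forall x (e : R), 0 < e -> exists i, `|x - y i| < e.
Hypothesis f_le : forall i x, f i x <= `|x|.
Hypothesis fy : forall i, f i (y i) = `|y i|.

(** Some ball of directions w shares the length 1 / (n+1) given by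
[polyhedral_segment]. Its midpoints x + w / (2 (n+1)) form an open set, which
contains some y_i. The functional f_i attains the norm at y_i, and the norm at
the midpoint y_i is the average of its values at the two ends, so f_i attains
the norm at both ends, one of which is x. *)
Lemma dense_norming_boundary x : exists i, f i x = `|x|.
Proof.
pose W (n : nat) := [set w : Y |
  `|2 *: x + n.+1%:R^-1 *: w| = `|x| + `|x + n.+1%:R^-1 *: w|].
have [||n [w [r [r0 rW]]]] := @baire_cover R Y W.
- move=> n.
  have -> : W n = [set w | `|2 *: x + n.+1%:R^-1 *: w|
                     - `|x + n.+1%:R^-1 *: w| = `|x|].
    apply/seteqP; split=> w; rewrite /W /=; first by move=> ->; rewrite addrK.
    by move/eqP; rewrite subr_eq => /eqP.
  apply: (@closed_comp _ _ (fun w : Y => `|2 *: x + n.+1%:R^-1 *: w|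
    - `|x + n.+1%:R^-1 *: w|) [set t : R | t = `|x|]).
    by move=> w _; apply: cvgB; apply: cvg_norm; apply: cvgD; (try exact: cvg_cst);
      apply: cvgZr; exact: cvg_id.
  exact: closed_eq.
- by move=> w; exact: polyhedral_segment.
have n0 : (0 : R) < 2 * n.+1%:R by rewrite mulr_gt0.
have [i iP] := y_dense (x + (2 * n.+1%:R)^-1 *: w) (divr_gt0 r0 n0).
exists i.
have /rW : `|w - (2 * n.+1%:R) *: (y i - x)| < r.
  have -> : w - (2 * n.+1%:R) *: (y i - x) =
    (2 * n.+1%:R) *: (x + (2 * n.+1%:R)^-1 *: w - y i).
    have -> : x + (2 * n.+1%:R)^-1 *: w - y i = (2 * n.+1%:R)^-1 *: w - (y i - x).
      by rewrite opprB [RHS]addrC addrAC.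
    by rewrite [RHS]scalerBr scalerA mulfV ?gt_eqF// scale1r.
  by rewrite normrZ gtr0_norm// mulrC -ltr_pdivlMr.
have E : n.+1%:R^-1 *: ((2 * n.+1%:R) *: (y i - x)) = 2 *: (y i - x).
  by rewrite scalerA mulrCA mulVf ?mulr1// pnatr_eq0.
rewrite /W /= E -scalerDr [x + (y i - x)]addrC subrK normrZ ger0_norm// => h.
have [] // := @eq_of_le_add R (f i x) `|x| (f i (x + 2 *: (y i - x))) `|x + 2 *: (y i - x)|.
rewrite -h -fy -[_ * _]/(2 *: (f i (y i) : R^o)) -linearZ -linearD; congr (f i _).
by rewrite addrA -mulr2n -scaler_nat -scalerDr [x + _]addrC subrK.
Qed.

End DenseNorming.

(** * Covering the dual of a polyhedral space by countably many balls *)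

Section DualCover.
Variables (R : realType) (Y : completeNormedModType R).
Variable (f : nat -> {linear Y -> R^o}).
Hypothesis f_le : forall i x, f i x <= `|x|.
Hypothesis f_bd : forall x, exists i, f i x = `|x|.

Let p (k : nat) (y : Y) : R := (1 + k.+1%:R^-1) * `|f k y|.

Let w_gt1 k : 1 < 1 + k.+1%:R^-1 :> R.
Proof. by rewrite ltrDl invr_gt0. Qed.

Let abs_f_le k y : `|f k y : R| <= `|y|.
Proof. by rewrite ler_norml f_le andbT lerNl -linearN -normrN f_le. Qed.

Let pD i x y : p i (x + y) <= p i x + p i y.
Proof.
rewrite -mulrDr ler_wpM2l ?(ltW (lt_trans ltr01 (w_gt1 _)))// linearD.
exact: ler_normD.
Qed.

Let pZ i a x : p i (a *: x) = `|a| * p i x.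
Proof. by rewrite /p linearZ normrM mulrCA. Qed.

Let pC i x : p i x <= 2 * `|x|.
Proof.
apply: ler_pM => //.
by rewrite -[leRHS]/(1 + 1) lerD2l invf_le1// ler1n.
Qed.

Let plim x (e : R) : 0 < e -> exists L, forall i, (L <= i)%N -> p i x <= `|x| + e.
Proof.
move=> e0; exists (Num.truncn (`|x| / e)) => i Li.
apply: (@le_trans _ _ ((1 + i.+1%:R^-1) * `|x|)).
  by rewrite ler_wpM2l// ltW// (lt_trans ltr01 (w_gt1 _)).
rewrite mulrDl mul1r lerD2l ler_pdivrMl// -ler_pdivrMr//.
have /ltW/le_trans := truncnS_gt (`|x| / e); apply.
by rewrite ler_nat ltnS.
Qed.

Let pgt x : x != 0 -> exists i, `|x| < p i x.
Proof.
move=> x0; have [i fx] := f_bd x; exists i.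
by rewrite /p fx normr_id ltr_pMl ?normr_gt0.
Qed.

Let lf : locally_finite p 2.
Proof. by split; [exact: pD|exact: pZ|exact: pC|exact: plim|exact: pgt]. Qed.

(** Ekeland's principle gives a point z of the unit ball of N that maximizes
g - |. - z| there. Along a direction h killed by the finitely many f_k that
matter around z, one does not leave the ball, so g(h) <= |h|. If z = 0, short
moves in any direction stay in the ball. *)
Lemma small_on_kernel (g : {linear Y -> R^o}) (K : R) :
  (forall y, `|g y : R| <= K * `|y|) ->
  exists L : nat, forall h, (forall k, (k < L)%N -> f k h = 0) -> g h <= `|h|.
Proof.
move=> gK; pose N := supnorm p.
have Nle x : `|x| <= N x by exact: (norm_le_supnorm lf).
have [|||||z [Nz _ zmax]] := @ekeland R Y [set x | N x <= 1] g K `|K| 1 0.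
- apply: (@closed_comp _ _ N [set t | t <= 1]); last exact: closed_le.
  by move=> x _; apply: (lipschitz_cont (K := 2)) => x' y'; exact: (supnorm_lipschitz lf).
- by rewrite /= /N (supnorm0 lf).
- by move=> x y; rewrite -linearB; exact: gK.
- move=> x /= N1; apply: le_trans (ler_norm _) _; apply: le_trans (gK x) _.
  apply: le_trans (ler_norm _) _; rewrite normrM ler_piMr// ger0_norm//.
  exact: le_trans (Nle x) N1.
- exact: ltr01.
have [L [r [r0 rP]]] : exists (L : nat) (r : R), 0 < r /\ forall h, `|h| <= r ->
    (forall k, (k < L)%N -> f k h = 0) -> N (z + h) <= 1.
  have [->|z0] := eqVneq z 0.
    exists 0%N, 2^-1; split=> // h hr _; rewrite add0r.
    by apply: le_trans (supnorm_le_norm lf h) _; rewrite -ler_pdivlMl ?mulr1.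
  have [L [r [r0 rP]]] := supnorm_locally_le lf z0.
  exists L, r; split=> // h /rP hr fh; apply: le_trans hr _.
  by rewrite big1 ?addr0// => k _; rewrite /p fh ?normr0 ?mulr0.
exists L => h fh.
pose t := r / (`|h| + 1).
have h1 : 0 < `|h| + 1 by rewrite ltr_wpDl.
have t0 : 0 < t by rewrite divr_gt0.
have Nt : N (z + t *: h) <= 1.
  apply: rP => [|k kL]; last by rewrite linearZ/= fh// scaler0.
  rewrite normrZ gtr0_norm// /t mulrAC ler_pdivrMr// ler_pM2l//.
  by rewrite lerDl.
have := zmax _ Nt; rewrite mul1r linearD lerD2l addrC addKr normrZ gtr0_norm//.
by rewrite linearZ ler_pM2l.
Qed.

(** One functional at a time, as in the one-dimensional step of the Hahn-Banach
theorem: on the common kernel K of the first L functionals, an admissible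
coefficient b of f_L exists because g(u) - |u| <= |v| - g(v) whenever u and v in
K satisfy f_L(u) = 1 and f_L(v) = -1, by the hypothesis on u + v. *)
Lemma span_of_small_on_kernel (L : nat) (g : {linear Y -> R^o}) :
  (forall h, (forall k, (k < L)%N -> f k h = 0) -> g h <= `|h|) ->
  exists a : nat -> R, forall y, (g y : R) - \sum_(k < L) a k * f k y <= `|y|.
Proof.
elim: L g => [|L IH] g gP.
  by exists (fun=> 0) => y; rewrite big_ord0 subr0; exact: gP.
pose K h := forall k, (k < L)%N -> f k h = 0.
have KD u v : K u -> K v -> K (u + v).
  by move=> Ku Kv k kL; rewrite linearD Ku// Kv// addr0.
have KZ a u : K u -> K (a *: u).
  by move=> Ku k kL; rewrite linearZ/= Ku// scaler0.
have [b bP] : exists b : R, forall h, K h -> (g h : R) - b * f L h <= `|h|.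
  pose S := [set (g u : R) - `|u| | u in [set u | K u /\ f L u = 1]].
  have gap u v : K u -> K v -> f L u = 1 -> f L v = - 1 -> (g u : R) - `|u| <= `|v| - g v.
    move=> Ku Kv fu fv; rewrite lerBlDr addrAC lerBrDr -linearD addrC.
    rewrite [leRHS]addrC; apply: le_trans (ler_normD _ _); rewrite addrC.
    apply: gP => k; rewrite ltnS leq_eqVlt => /predU1P[->|kL].
      by rewrite linearD fu fv ?addNr ?subrr.
    exact: KD.
  have [[u0 [Ku0 fu0]]|nS] := pselect (exists u, K u /\ f L u = 1); last first.
    exists 0 => h Kh; rewrite mul0r subr0.
    apply: gP => k; rewrite ltnS leq_eqVlt => /predU1P[->|]; last exact: Kh.
    apply/eqP; apply: contrapT => /negP fh; apply: nS.
    exists ((f L h : R)^-1 *: h); split; first exact: KZ.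
    by rewrite linearZ; exact: mulVf.
  have supS : has_sup S.
    split; first by exists (g u0 - `|u0|), u0.
    exists (`|- u0| - g (- u0)) => _ [u [Ku fu] <-]; apply: gap => //.
      by rewrite -scaleN1r; exact: KZ.
    by rewrite linearN fu0.
  exists (sup S) => h Kh.
  have scal (c : R) : 0 < c -> (g (c^-1 *: h) : R) - sup S * f L (c^-1 *: h) <= `|c^-1 *: h| ->
      (g h : R) - sup S * f L h <= `|h|.
    move=> c0; rewrite (linearZR g) (linearZR (f L)) normrZ gtr0_norm ?invr_gt0// mulrCA -mulrBr.
    by rewrite ler_pM2l// invr_gt0.
  have [fh|fh|fh] := ltgtP (f L h : R) 0.
  - apply: (scal (- f L h)); first by rewrite oppr_gt0.
    have fh1 : f L ((- f L h : R)^-1 *: h) = - 1.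
      by rewrite linearZR invrN mulNr mulVf ?lt_eqF.
    rewrite fh1 mulrN1 opprK -lerBrDl.
    apply: ge_sup; first exact: supS.1.
    by move=> _ [u [Ku fu] <-]; apply: gap => //; exact: KZ.
  - apply: (scal (f L h)) => //.
    have fh1 : f L ((f L h : R)^-1 *: h) = 1.
      by rewrite linearZR mulVf ?gt_eqF.
    rewrite fh1 mulr1 lerBlDr addrC -lerBlDr.
    apply: sup_upper_bound => //.
    by exists ((f L h : R)^-1 *: h) => //; split=> //; exact: KZ.
  - rewrite fh mulr0 subr0; apply: gP => k.
    by rewrite ltnS leq_eqVlt => /predU1P[->|] //; exact: Kh.
have [|a aP] := IH (g \- (b \*: f L)); first exact: bP.
exists (fun k => if (k < L)%N then a k else b) => y.
rewrite big_ord_recr/= ltnn opprD addrA addrAC.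
have -> : \sum_(i < L) (if (i < L)%N then a i else b) * f i y = \sum_(i < L) a i * f i y.
  by apply: eq_bigr => i _; rewrite ltn_ord.
exact: aP.
Qed.

(** The centres are the rational combinations of the f_k, enumerated through the
countable type of lists of rational numbers. *)
Lemma dual_cover : exists s : nat -> Y -> R, forall (g : {linear Y -> R^o}) (K : R),
  (forall y, `|g y : R| <= K * `|y|) ->
  exists l, forall y, `|(g y : R) - s l y| <= 2 * `|y|.
Proof.
pose s (l : nat) (y : Y) : R :=
  let q : seq rat := odflt [::] (unpickle l) in
  \sum_(k < size q) ratr q`_k * f k y.
exists s => g K gK.
have [L gL] := small_on_kernel gK.
have [a aP] := span_of_small_on_kernel gL.
have {}aP y : `|(g y : R) - \sum_(k < L) a k * f k y| <= `|y|.
  rewrite ler_norml aP andbT lerNl -normrN.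
  have <- : (g (- y) : R) - \sum_(k < L) a k * f k (- y) =
      - ((g y : R) - \sum_(k < L) a k * f k y).
    rewrite linearN opprB addrC; congr (_ + _); rewrite -sumrN.
    by apply: eq_bigr => k _; rewrite linearN mulrN opprK.
  exact: aP.
have /choice[r rP] : forall k, exists q : rat, `|a k - ratr q| <= L.+1%:R^-1.
  move=> k; have : a k - L.+1%:R^-1 < a k + L.+1%:R^-1.
    by rewrite ltrD2l gtrN// invr_gt0.
  move=> /rat_in_itvoo[q]; rewrite in_itv/= => /andP[q1 q2]; exists q.
  by rewrite ler_distlC !ltW.
exists (pickle (mkseq r L)) => y; rewrite /s pickleK /= size_mkseq.
have -> : (g y : R) - \sum_(k < L) ratr (mkseq r L)`_k * f k y =
    ((g y : R) - \sum_(k < L) a k * f k y)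
    + \sum_(k < L) (a k - ratr (r k)) * f k y.
  rewrite -addrA; congr (_ + _); rewrite -!sumrN -big_split/=.
  by apply: eq_bigr => k _; rewrite nth_mkseq// mulrBl addrA addNr add0r.
apply: le_trans (ler_normD _ _) _.
rewrite [2]/(1 + 1) mulrDl mul1r; apply: lerD; first exact: aP.
apply: le_trans (ler_norm_sum _ _ _) _.
apply: (@le_trans _ _ (\sum_(k < L) L.+1%:R^-1 * `|y|)).
  by apply: ler_sum => k _; rewrite normrM; apply: ler_pM.
rewrite sumr_const card_ord -[leLHS]mulr_natl mulrA ler_piMl//.
by rewrite ler_pdivrMr// mul1r ler_nat.
Qed.

End DualCover.

(** * The seminorms on X *)

Section Net.
Variables (R : realType) (Y : lmodType R).

Lemma dist_of_truncn (a b : R) : 0 <= a -> 0 <= b ->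
  Num.truncn a = Num.truncn b -> `|a - b| <= 1.
Proof.
move=> a0 b0 ab; have := truncn_le a; have := truncn_le b.
rewrite a0 b0 => hb ha; have ha' := truncnS_gt a; have hb' := truncnS_gt b.
move: ha hb ha' hb'; rewrite ab -natr1; move: (_%:R) => n.
by rewrite ler_norml => ? ? ? ?; apply/andP; split; lra.
Qed.

(** The values at z_k of the functionals within b of c lie in bounded intervals;
these are cut into cells of length rho, and one functional is kept for each
nonempty cell. The bound b applies at all points, so that the chosen functional
is also close to g globally. *)
Lemma finite_net (P : {linear Y -> R^o} -> Prop) (c : Y -> R) (b : Y -> R)
    (l : nat) (z : 'I_l -> Y) (rho : R) (g0 : {linear Y -> R^o}) : 0 < rho ->
  P g0 ->
  exists (M : nat) (d : nat -> {linear Y -> R^o}),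
    (forall i, P (d i)) /\
    forall g, P g -> (forall x, `|(g x : R) - c x| <= b x) ->
    exists i, [/\ (i < M)%N, forall x, `|(d i x : R) - c x| <= b x
      & forall k, `|(g (z k) : R) - d i (z k)| <= rho].
Proof.
move=> rho0 Pg0.
pose v (g : {linear Y -> R^o}) k : R := ((g (z k) : R) - c (z k) + b (z k)) / rho.
pose N := \max_(k < l) Num.truncn (2 * b (z k) / rho).
pose cell g : {ffun 'I_l -> 'I_N.+1} := [ffun k => inord (Num.truncn (v g k))].
pose Q (g : {linear Y -> R^o}) := P g /\ forall x, `|(g x : R) - c x| <= b x.
have /choice[d dP] : forall s : {ffun 'I_l -> 'I_N.+1}, exists g,
    P g /\ ((exists h, Q h /\ cell h = s) -> Q g /\ cell g = s).
  move=> s; have [[h [Qh hs]]|n] := pselect (exists h, Q h /\ cell h = s).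
    by exists h; split=> //; exact: Qh.1.
  by exists g0; split.
pose s0 : {ffun 'I_l -> 'I_N.+1} := [ffun=> ord0].
exists #|{ffun 'I_l -> 'I_N.+1}|, (fun i => d (nth s0 (enum {ffun 'I_l -> 'I_N.+1}) i)).
split=> [i|g Pg gb]; first exact: (dP _).1.
exists (index (cell g) (enum {ffun 'I_l -> 'I_N.+1})).
have cE : cell g \in enum {ffun 'I_l -> 'I_N.+1} by rewrite mem_enum.
rewrite nth_index//; have [|[_ db] dc] := (dP (cell g)).2; first by exists g.
split=> //; first by rewrite cardE index_mem.
move=> k.
have vP (h : {linear Y -> R^o}) : (forall x, `|(h x : R) - c x| <= b x) ->
    0 <= v h k /\ (Num.truncn (v h k) < N.+1)%N.
  move=> hb; have := hb (z k); rewrite ler_norml => /andP[h1 h2].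
  split; first by rewrite divr_ge0 ?(ltW rho0)// -lerBlDr sub0r.
  rewrite ltnS; apply: leq_trans (leq_bigmax k); apply: le_truncn.
  by rewrite ler_pM2r ?invr_gt0// [2]/(1 + 1) mulrDl mul1r lerD2r.
have [g1 g2] := vP g gb; have [d1 d2] := vP _ db.
have : Num.truncn (v g k) = Num.truncn (v (d (cell g)) k).
  by have := congr1 (fun s : {ffun 'I_l -> 'I_N.+1} => val (s k)) dc; rewrite /= !ffunE !inordK.
move=> /(dist_of_truncn g1 d1).
rewrite /v -mulrBl normrM (gtr0_norm (_ : 0 < rho^-1)) ?invr_gt0//.
rewrite ler_pdivrMr// mul1r; apply: le_trans.
by rewrite opprD addrACA subrr addr0 opprB addrA subrK.
Qed.

End Net.

Section Pieces.
Variables (R : realType) (X Y : normedModType R) (T : {linear X -> Y}) (K : R).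
Hypothesis K0 : 0 <= K.
Hypothesis TK : forall x, `|T x| <= K * `|x|.
Hypothesis polyY : polyhedral Y.
Variable y : nat -> Y.
Hypothesis y_dense : forall x (e : R), 0 < e -> exists i, `|x - y i| < e.
Variable s : nat -> Y -> R.

Definition contracting (g : {linear Y -> R^o}) :=
  (exists C : R, forall v, `|g v : R| <= C * `|v|) /\
  forall x, `|g (T x) : R| <= `|x|.

Hypothesis s_cover : forall g : {linear Y -> R^o}, contracting g ->
  exists l, forall v, `|(g v : R) - s l v| <= 2 * `|v|.
Hypothesis contracting_boundary : forall x, exists2 g, contracting g & g (T x) = `|x|.

Definition rad (l : nat) : R := l.+1%:R^-1.

Lemma rad_gt0 l : 0 < rad l. Proof. by rewrite invr_gt0. Qed.

(** Two functionals in the l-th ball differ by at most 4 in norm, and by at most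
4 * rad l at y_k for k < l if they are in the same cell of the net; their
difference is then at most 4 times the damped norm. *)
Lemma nets_exist : exists (M : nat -> nat) (d : nat -> nat -> {linear Y -> R^o}),
  (forall l i, contracting (d l i)) /\
  forall g, contracting g -> exists l i, (i < M l)%N /\
    forall v, (g v : R) <= `|d l i v : R| + 4 * damped_norm (fun k : 'I_l => y k) (rad l) v.
Proof.
have c0 : contracting \0.
  split; first by exists 0 => v; rewrite normr0 mul0r.
  by move=> x; rewrite normr0.
have /choice[M /choice[d dP]] : forall l, exists (M : nat) (d : nat -> {linear Y -> R^o}),
    (forall i, contracting (d i)) /\
    forall g, contracting g -> (forall x, `|(g x : R) - s l x| <= 2 * `|x|) ->
    exists i, [/\ (i < M)%N, forall x, `|(d i x : R) - s l x| <= 2 * `|x|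
      & forall k : 'I_l, `|(g (y k) : R) - d i (y k)| <= 4 * rad l].
  by move=> l; apply: (finite_net _ _ (fun k : 'I_l => y k) _ c0); rewrite mulr_gt0// rad_gt0.
exists M, d; split=> [l i|g cg]; first exact: (dP l).1.
have [l gl] := s_cover cg.
have [i [iM dl gd]] := (dP l).2 g cg gl.
exists l, i; split=> // v; rewrite -lerBlDl.
apply: (@le_trans _ _ ((g \- d l i) v : R)).
  by rewrite /= lerD2l lerN2 ler_norm.
apply: le_damped_norm => [|u|k]; [exact: rad_gt0| |exact: gd k].
  apply: le_trans (ler_norm _) _ => /=.
  apply: le_trans (ler_distD (s l u) _ _) _.
  rewrite (_ : 4 = 2 + 2); last by rewrite -natrD.
  by rewrite mulrDl lerD// distrC.
Qed.

Variables (M : nat -> nat) (d : nat -> nat -> {linear Y -> R^o}).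
Hypothesis d_contr : forall l i, contracting (d l i).
Hypothesis d_net : forall g, contracting g -> exists l i, (i < M l)%N /\
    forall v, (g v : R) <= `|d l i v : R| + 4 * damped_norm (fun k : 'I_l => y k) (rad l) v.

Let D (l : nat) : Y -> R := damped_norm (fun k : 'I_l => y k) (rad l).
Let m (l : nat) (x : X) : R := \big[Num.max/0]_(i < M l) `|d l i (T x) : R|.

Definition piece (l : nat) (x : X) : R := (1 + rad l) * (m l x + 4 * D l (T x)).

Let rad1_gt1 l : 1 < 1 + rad l. Proof. by rewrite ltrDl rad_gt0. Qed.
Let rad1_ge0 l : 0 <= 1 + rad l. Proof. exact: ltW (lt_trans ltr01 _). Qed.
Let rad_le1 l : rad l <= 1. Proof. by rewrite invf_le1// ler1n. Qed.

Let m_ge0 l x : 0 <= m l x. Proof. by apply/bigmax_geP; left. Qed.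

Let mD l u v : m l (u + v) <= m l u + m l v.
Proof.
apply/bigmax_leP; split=> [|i _]; first exact: addr_ge0.
rewrite !linearD; apply: le_trans (ler_normD _ _) _.
by apply: lerD; exact: le_bigmax.
Qed.

Let mZ l a u : m l (a *: u) <= `|a| * m l u.
Proof.
apply/bigmax_leP; split=> [|i _]; first exact: mulr_ge0.
by rewrite !linearZ/= normrM ler_wpM2l//; exact: le_bigmax.
Qed.

Let m_le l x : m l x <= `|x|.
Proof. by apply/bigmax_leP; split=> [|i _] //; exact: (d_contr l i).2. Qed.

Let D_ge0 l v : 0 <= D l v. Proof. exact: damped_norm_ge0 (rad_gt0 l) _. Qed.
Let D_le l v : D l v <= `|v|. Proof. exact: damped_norm_le_norm (rad_gt0 l) _. Qed.

Lemma pieceD l u v : piece l (u + v) <= piece l u + piece l v.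
Proof.
rewrite -mulrDr ler_wpM2l// addrACA -mulrDr linearD; apply: lerD; first exact: mD.
by rewrite ler_wpM2l//; exact: damped_normD (rad_gt0 l) _ _.
Qed.

Lemma pieceZ l a u : piece l (a *: u) = `|a| * piece l u.
Proof.
rewrite /piece linearZ /D (damped_normZ _ (rad_gt0 l)) -/(D _ _).
by rewrite (abs_homogeneous (m_ge0 l) (mZ l)) [4 * _]mulrCA -mulrDr mulrCA.
Qed.

Lemma piece_le l x : piece l x <= 2 * (1 + 4 * K) * `|x|.
Proof.
rewrite /piece -[leRHS]mulrA; apply: ler_pM => //.
- by rewrite addr_ge0// mulr_ge0.
- by rewrite [leRHS]/(1 + 1) lerD2l.
- rewrite [leRHS]mulrDl mul1r -[X in _ <= _ + X]mulrA; apply: lerD => //; rewrite ler_wpM2l//.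
  exact: le_trans (D_le _ _) (TK _).
Qed.

Lemma piece_le_image l : exists C : R, forall x, piece l x <= C * `|T x|.
Proof.
have /choice[C CP] : forall i, exists C : R, forall v, `|d l i v : R| <= C * `|v|.
  by move=> i; exact: (d_contr l i).1.
exists ((1 + rad l) * (\sum_(i < M l) `|C i| + 4)) => x.
rewrite -mulrA ler_wpM2l// [leRHS]mulrDl; apply: lerD; last by rewrite ler_wpM2l.
apply/bigmax_leP; split=> [|i _]; first by rewrite mulr_ge0// sumr_ge0.
apply: le_trans (CP _ _) _; rewrite ler_wpM2r// (bigD1 i)//=.
by apply: le_trans (ler_norm _) _; rewrite lerDl sumr_ge0.
Qed.

Lemma piece_lim x (e : R) : 0 < e ->
  exists L, forall l, (L <= l)%N -> piece l x <= `|x| + e.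
Proof.
move=> e0; have e32 : 0 < e / 32 by rewrite divr_gt0.
have [k kP] := y_dense (T x) e32.
exists (maxn k.+1 (Num.truncn ((`|x| + 1) / (e / 32)))) => l.
rewrite geq_max => /andP[kl tl].
have rl : (`|x| + 1) * rad l <= e / 32.
  rewrite ler_pdivrMr// mulrC -ler_pdivrMr//.
  by have /ltW/le_trans := truncnS_gt ((`|x| + 1) / (e / 32)); apply; rewrite ler_nat ltnS.
have Dl : D l (T x) <= e / 32 + rad l.
  apply: le_trans (damped_norm_le_dist _ (rad_gt0 l) _ (Ordinal kl)) _.
  by rewrite lerD2r ltW.
have := m_le l x; have := rad_gt0 l; have := rad_le1 l; have := D_ge0 l (T x).
have := normr_ge0 x; move: rl Dl; rewrite /piece.
move: `|x| (rad l) (D l (T x)) (m l x) => {kP kl tl} a r t u.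
move=> h1 h2 h3 h4 h5 h6 h7; nra.
Qed.

Lemma piece_gt x : x != 0 -> exists l, `|x| < piece l x.
Proof.
move=> x0; have [g cg gx] := contracting_boundary x.
have [l [i [iM gl]]] := d_net cg; exists l.
have xle : `|x| <= m l x + 4 * D l (T x).
  rewrite -gx; apply: le_trans (gl _) _; rewrite lerD2r.
  exact: (le_bigmax _ (fun i : 'I_(M l) => `|d l i (T x) : R|) (Ordinal iM)).
apply: lt_le_trans (_ : (1 + rad l) * `|x| <= _); last by rewrite ler_wpM2l.
by rewrite ltr_pMl ?normr_gt0.
Qed.

Lemma piece_finitely_normed (F : set X) l :
  finite_dim_subspace F -> finitely_normed F (piece l).
Proof.
move=> [n [e Fe]].
pose G := linear_span (fun i => T (e i)).
have fG : finite_dim_subspace G by exists n, (fun i => T (e i)).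
have TG v : F v -> G (T v).
  rewrite Fe => /linear_spanP[c ->]; apply/linear_spanP; exists c.
  by rewrite linear_sum; apply: eq_bigr => i _; rewrite linearZ.
apply: finitely_normedZ => //; apply: finitely_normedD.
  apply: (@finitely_normed_bigmax _ _ F (M l) (fun i v => `|d l i (T v) : R|)) => i.
  exact: (@finitely_normed_comp _ _ _ T F G (fun v => `|d l i v : R|) TG (finitely_normed_abs _ _)).
apply: finitely_normedZ => //.
by apply: (finitely_normed_comp TG); apply: polyhedral_damped_norm => //; exact: rad_gt0.
Qed.

End Pieces.

(** * Polyhedrality of the supremum *)

Lemma finite_dim_free (R : realType) (V : lmodType R) (F : set V) :
  finite_dim_subspace F -> exists (n : nat) (e : 'I_n -> V),
    F = linear_span e /\
    forall c : 'I_n -> R, \sum_i c i *: e i = 0 -> forall i, c i = 0.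
Proof.
move=> [n0 [e0 Fe0]].
pose P n := `[< exists e : 'I_n -> V, F = linear_span e >].
have exP : exists n, P n by exists n0; apply/asboolP; exists e0.
case: (ex_minnP exP) => n /asboolP[e Fe] nmin; exists n, e; split=> // c c0 j.
apply/eqP; apply: contrapT => /negP cj.
case: n => [|n] in e Fe nmin c c0 j cj *; first by case: j cj.
suff /nmin : P n by rewrite ltnn.
apply/asboolP; exists (fun i => e (lift j i)); rewrite Fe.
have ej : e j = - \sum_i (c (lift j i) / c j) *: e (lift j i).
  apply: (scalerI cj); rewrite scalerN scaler_sumr.
  move: c0; rewrite (bigD1_ord j)//= => /eqP; rewrite addr_eq0 => /eqP ->.
  by congr (- _); apply: eq_bigr => i _; rewrite scalerA mulrCA mulfV// mulr1.
apply/seteqP; split=> v /linear_spanP[a ->]; apply/linear_spanP.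
  exists (fun i => a (lift j i) - a j * (c (lift j i) / c j)).
  rewrite (bigD1_ord j)//= ej scalerN scaler_sumr addrC -sumrB.
  by apply: eq_bigr => i _; rewrite scalerBl scalerA.
exists (fun i => if unlift j i is Some k then a k else 0).
rewrite (bigD1_ord j)//= unlift_none scale0r add0r.
by apply: eq_bigr => i _; rewrite liftK.
Qed.

Section SupnormPolyhedral.
Variables (R : realType) (V : normedModType R) (p : nat -> V -> R) (C : R).
Hypothesis lf : locally_finite p C.

(** Around each point of the compact unit sphere of the coefficient space,
finitely many p_i suffice; hence finitely many suffice on the whole sphere, and
on F by homogeneity. The basis has to be free for the vectors on the sphere to
be nonzero. *)
Lemma supnorm_finitely_normed (F : set V) : finite_dim_subspace F ->
  (forall i, finitely_normed F (p i)) -> finitely_normed F (supnorm p).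
Proof.
move=> /finite_dim_free[n [e [Fe free_e]]] pF.
pose x (c : 'rV[R]_n) : V := \sum_i c 0 i *: e i.
have x0 c : c != 0 -> x c != 0.
  apply: contra => /eqP/(free_e (fun i => c 0 i)) h; apply/eqP/rowP => i.
  by rewrite h mxE.
have xB c c' : `|x c' - x c| <= (\sum_i `|e i|) * `|c - c'|.
  rewrite /x -sumrB; apply: le_trans (ler_norm_sum _ _ _) _; rewrite mulr_suml.
  apply: ler_sum => i _; rewrite -scalerBl normrZ mulrC ler_wpM2l//.
  by have := mx_coord_le (c - c') i; rewrite !mxE distrC.
have Kcpt : compact [set c : 'rV[R]_n | `|c| = 1].
  apply: bounded_closed_compact.
    exists 1; split; first exact: num_real.
    by move=> K K1 c /= ->; exact: ltW.
  apply: (@closed_comp _ _ (fun c : 'rV[R]_n => `|c|) [set t : R | t = 1]).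
    by move=> c _; exact: norm_continuous.
  exact: closed_eq.
have [N _ /(_ N (leqnn _)) NP] : \forall N \near \oo,
    [set c : 'rV[R]_n | `|c| = 1] `<=`
    (fun c => exists2 i, (i < N)%N & supnorm p (x c) = p i (x c)).
  apply: ((compact_near_coveringP _).1 Kcpt) => c /= c1.
  have c0 : c != 0 by rewrite -normr_gt0 c1.
  have [L [r [r0 rP]]] := supnorm_locally_max lf (x0 c c0).
  have S0 : 0 < \sum_i `|e i| + 1 by rewrite ltr_wpDl// sumr_ge0.
  exists (ball c (r / (\sum_i `|e i| + 1)), [set N | (L <= N)%N]).
    split=> /=; last by exists L.
    by apply: nbhsx_ballx; rewrite divr_gt0.
  move=> [c' N] [/= cc' LN].
  have [|i iL iP] := rP (x c' - x c).
    apply: le_trans (xB _ _) _.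
    move: cc'; rewrite -ball_normE /= ltr_pdivlMr// => /ltW; apply: le_trans.
    by rewrite mulrC ler_wpM2l// lerDl.
  by exists i; [exact: leq_trans iL LN|rewrite addrC subrK in iP].
apply: (@finitely_normed_sup _ _ F N.+1 (fun i => p i)) => [i|i v _|v].
- exact: pF.
- exact: le_supnorm lf _ _.
- rewrite Fe => /linear_spanP[a va].
  pose c : 'rV[R]_n := \row_i a i.
  have vc : v = x c by rewrite va; apply: eq_bigr => i _; rewrite mxE.
  have [c0|c0] := eqVneq c 0.
    exists ord0; rewrite vc c0 /x big1 => [|i _]; last by rewrite mxE scale0r.
    by rewrite (supnorm0 lf) (seminorm0 lf).
  have c1 : 0 < `|c| by rewrite normr_gt0.
  have [|i iN] := NP (`|c|^-1 *: c).
    by rewrite /= normrZ normfV normr_id mulVf ?gt_eqF.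
  have -> : x (`|c|^-1 *: c) = `|c|^-1 *: v.
    by rewrite vc scaler_sumr; apply: eq_bigr => j _; rewrite mxE scalerA.
  rewrite (supnormZ lf) (lf_scale lf) => /(mulfI _) h.
  exists (Ordinal (ltnW iN : (i < N.+1)%N)); apply: h.
  by rewrite normr_eq0 invr_eq0 gt_eqF.
Qed.

End SupnormPolyhedral.

(** * Separability *)

Section Separability.
Variables (R : realType) (X : completeNormedModType R) (Y : normedModType R).
Variables (T : {linear X -> Y}) (p : nat -> X -> R) (C : R).
Hypothesis lf : locally_finite p C.
Hypothesis pT : forall i, exists C : R, forall x, p i x <= C * `|T x|.
Variable y : nat -> Y.
Hypothesis y_dense : forall x (e : R), 0 < e -> exists i, `|x - y i| < e.

Let N := supnorm p.

(** A subset of a separable metric space is separable: for each y_i and each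
radius choose, if possible, a point of the unit ball of N whose image is
that close to y_i. *)
Lemma dense_preimages : exists d : nat -> X, (forall n, N (d n) <= 1) /\
  forall x (e : R), N x <= 1 -> 0 < e -> exists n, `|T x - T (d n)| < e.
Proof.
have /choice[d dP] : forall n, exists x : X, N x <= 1 /\
    forall i k, unpickle n = Some (i, k) ->
    (exists2 x', N x' <= 1 & `|T x' - y i| < k.+1%:R^-1) -> `|T x - y i| < k.+1%:R^-1.
  move=> n; case: (unpickle n) => [[i k]|]; last first.
    by exists 0; split=> //; rewrite /N (supnorm0 lf).
  have [[x Nx xy]|h] := pselect (exists2 x', N x' <= 1 & `|T x' - y i| < k.+1%:R^-1).
    by exists x; split=> // _ _ [<- <-].
  by exists 0; rewrite /N (supnorm0 lf); split=> // _ _ [<- <-] /h.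
exists d; split=> [n|x e Nx e0]; first exact: (dP n).1.
pose k := Num.truncn (2 / e).
have ke : k.+1%:R^-1 * 2 <= e.
  by rewrite ler_pdivrMl// -ler_pdivrMr// ltW// truncnS_gt.
have k0 : 0 < k.+1%:R^-1 :> R by rewrite invr_gt0.
have [i ix] := y_dense (T x) k0.
exists (pickle (i, k)).
have := (dP (pickle (i, k))).2 i k (pickleK _) (ex_intro2 _ _ x Nx ix) => dy.
apply: lt_le_trans ke; rewrite -[2]/(1 + 1) mulrDr mulr1.
apply: le_lt_trans (ler_distD (y i) _ _) _; apply: ltrD => //.
by rewrite distrC.
Qed.

Variable d : nat -> X.
Hypothesis Nd : forall n, N (d n) <= 1.
Hypothesis d_dense : forall x (e : R), N x <= 1 -> 0 < e ->
  exists n, `|T x - T (d n)| < e.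

Inductive seq_span : X -> Prop :=
| seq_span0 : seq_span 0
| seq_spanS (a : R) n u : seq_span u -> seq_span (a *: d n + u).

Lemma seq_spanD u v : seq_span u -> seq_span v -> seq_span (u + v).
Proof.
by move=> su sv; elim: su => [|a n u' _ IH]; rewrite ?add0r// -addrA; constructor.
Qed.

Lemma seq_spanZ a u : seq_span u -> seq_span (a *: u).
Proof.
elim=> [|b n u' _ IH]; first by rewrite scaler0; constructor.
by rewrite scalerDr scalerA; constructor.
Qed.

Lemma seq_span_d a n : seq_span (a *: d n).
Proof. by rewrite -[_ *: _]addr0; do 2!constructor. Qed.

Let rho (x : X) : R := inf [set `|x - u| | u in seq_span].

Let rho_inf x : has_inf [set `|x - u| | u in seq_span].
Proof.
split; first by exists `|x - 0|, 0 => //; constructor.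
by exists 0 => _ [u _ <-].
Qed.

Let rho_le x u : seq_span u -> rho x <= `|x - u|.
Proof. by move=> su; apply: ge_inf; [exact: (rho_inf x).2|exists u]. Qed.

Let le_rho x c : (forall u, seq_span u -> c <= `|x - u|) -> c <= rho x.
Proof.
move=> h; apply: lb_le_inf; first exact: (rho_inf x).1.
by move=> _ [u su <-]; exact: h.
Qed.

Let rho_lip x z : `|rho x - rho z| <= 1 * `|x - z|.
Proof.
have H a b : rho a - rho b <= `|a - b|.
  rewrite lerBlDl -lerBlDr; apply: le_rho => u su; rewrite lerBlDr.
  by apply: le_trans (rho_le a su) _; rewrite [leRHS]addrC; exact: ler_distD.
rewrite mul1r ler_norml H andbT lerNl opprB; apply: le_trans (H z x) _.
by rewrite distrC.
Qed.

Let rho_scale a x u : 0 < a -> seq_span u -> a * rho x <= rho (a *: x + u).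
Proof.
move=> a0 su; apply: le_rho => v sv.
have -> : a *: x + u - v = a *: (x - a^-1 *: (v - u)).
  by rewrite scalerBr scalerA mulfV ?gt_eqF// scale1r opprB addrA.
rewrite normrZ gtr0_norm// ler_pM2l//; apply: rho_le.
apply: seq_spanZ; apply: seq_spanD => //.
by rewrite -scaleN1r; exact: seq_spanZ.
Qed.

(** Let z be given by Ekeland's principle for the distance rho to the span, on
the unit ball of N, and choose n such that T (d n) is close to T z. With
h = z - d n, the distance at z + s h is at least (1 + s) rho(z), whereas
N (z + s h) <= 1 + s / 2. After division by 1 + s / 2 the point is back in the
ball, with a distance too large for the maximality of z. *)
Lemma seq_span_dist0 x : rho x <= 0.
Proof.
rewrite leNgt; apply/negP => rx.
have Nle u : `|u| <= N u by exact: (norm_le_supnorm lf).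
have rho0 : rho 0 <= 0.
  by apply: le_trans (rho_le 0 seq_span0) _; rewrite subr0 normr0.
have x0 : x != 0 by apply: contraTneq rx => ->; rewrite -leNgt.
have Nx : 0 < N x by apply: lt_le_trans (Nle x); rewrite normr_gt0.
pose x1 := (N x)^-1 *: x.
have r1 : 0 < rho x1.
  apply: lt_le_trans (_ : (N x)^-1 * rho x <= _); first by rewrite mulr_gt0// invr_gt0.
  have := @rho_scale (N x)^-1 x 0; rewrite addr0; apply; first by rewrite invr_gt0.
  exact: seq_span0.
pose e := rho x1 / 10.
have e0 : 0 < e by rewrite divr_gt0.
have [|||z [Nz rz zmax]] := @ekeland R X [set u | N u <= 1] rho 1 1 e x1 _ _ rho_lip _ e0.
- apply: (@closed_comp _ _ N [set t | t <= 1]); last exact: closed_le.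
  by move=> u _; apply: (lipschitz_cont (K := C)) => a b; exact: (supnorm_lipschitz lf).
- by rewrite /= /N (supnormZ lf) normfV ger0_norm ?(ltW Nx)// mulVf// gt_eqF.
- move=> u /= Nu; apply: le_trans (rho_le u seq_span0) _; rewrite subr0.
  exact: le_trans (Nle u) Nu.
have rz0 : 0 < rho z := lt_le_trans r1 rz.
have z0 : z != 0 by apply: contraTneq rz0 => ->; rewrite -leNgt.
have [L [del [del0 delP]]] := supnorm_locally_le lf z0.
have /choice[c cP] := pT.
pose S := \sum_(i < L) `|c i|.
have S0 : 0 <= S by rewrite sumr_ge0.
have S1 : 0 < S + 1 by rewrite ltr_wpDl.
have eta0 : 0 < (2 * (S + 1))^-1 by rewrite invr_gt0 mulr_gt0.
have [n dn] := d_dense Nz eta0.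
pose h := z - d n.
have hn : `|h| <= 2.
  apply: le_trans (ler_normB _ _) _; rewrite -[2]/(1 + 1); apply: lerD.
    exact: le_trans (Nle z) Nz.
  exact: le_trans (Nle _) (Nd n).
pose s := Num.min del 1 / 2.
have s0 : 0 < s by rewrite divr_gt0// lt_min del0 ltr01.
have sh : `|s *: h| <= 2 * s by rewrite normrZ gtr0_norm// mulrC ler_wpM2r// ltW.
have sdel : 2 * s <= del by rewrite mulrC divfK// ge_min lexx.
pose sg := s / 2.
have sg0 : 0 < sg by rewrite divr_gt0.
have sg1 : 0 < 1 + sg by rewrite addr_gt0.
have Nzh : N (z + s *: h) <= 1 + sg.
  apply: le_trans (delP _ (le_trans sh sdel)) _; apply: lerD => //.
  apply: (@le_trans _ _ (S * `|T (s *: h)|)).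
    rewrite mulr_suml; apply: ler_sum => i _; apply: le_trans (cP _ _) _.
    by rewrite ler_wpM2r// ler_norm.
  rewrite linearZ/= normrZ gtr0_norm// mulrCA /sg ler_pM2l//.
  rewrite linearB/=; apply: (@le_trans _ _ ((S + 1) * (2 * (S + 1))^-1)).
    by apply: ler_pM => //; [rewrite lerDl|exact: ltW].
  by rewrite invfM mulrCA mulfV ?gt_eqF// mulr1.
pose w := (1 + sg)^-1 *: (z + s *: h).
have Nw : N w <= 1.
  by rewrite /N (supnormZ lf) gtr0_norm ?invr_gt0// ler_pdivrMl// mulr1.
have := zmax w Nw; rewrite -(ler_pM2l sg1) mulrDr => wz.
apply: (@growth_contradiction R (rho z) (rho x1) s e sg) => //.
apply: (@le_trans _ _ ((1 + sg) * rho w)).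
  rewrite [leRHS]mulrC -ler_pdivrMr// mulrAC.
  have -> : w = ((1 + s) / (1 + sg)) *: z + (- (s / (1 + sg))) *: d n.
    rewrite /w /h scalerDr scalerA scalerBr addrA -scalerDl scaleNr.
    by rewrite mulrDl mul1r [s / _]mulrC.
  by apply: rho_scale; [rewrite divr_gt0// addr_gt0|exact: seq_span_d].
apply: le_trans wz _; rewrite lerD2l mulrCA ler_pM2l//.
have -> : (1 + sg) * `|w - z| = `|s *: h - sg *: z|.
  rewrite -[X in X * _](gtr0_norm sg1) -normrZ scalerBr /w scalerA mulfV ?gt_eqF//.
  by rewrite scale1r scalerDl scale1r opprD addrACA subrr add0r.
apply: le_trans (ler_normB _ _) _; apply: lerD => //.
rewrite normrZ gtr0_norm// ler_piMr ?(ltW sg0)//.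
exact: le_trans (Nle z) Nz.
Qed.

Let ratcomb (q : seq (rat * nat)) : X :=
  foldr (fun r u => ratr r.1 *: d r.2 + u) 0 q.

Lemma ratcomb_dense u (e : R) : seq_span u -> 0 < e -> exists q, `|u - ratcomb q| < e.
Proof.
move=> su; elim: su e => [|a n v _ IH] e e0.
  by exists [::]; rewrite subrr normr0.
have e2 : 0 < e / 2 by rewrite divr_gt0.
have [q qP] := IH _ e2.
have [r rP] : exists r : rat, `|a - ratr r| < e / 2.
  have : a - e / 2 < a + e / 2 by rewrite ltrD2l gtrN.
  move=> /rat_in_itvoo[r]; rewrite in_itv/= => /andP[r1 r2]; exists r.
  by rewrite ltr_distlC r1 r2.
exists ((r, n) :: q) => /=; rewrite opprD addrACA -scalerBl.
apply: le_lt_trans (ler_normD _ _) _; rewrite [e]splitr.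
apply: ler_ltD => //; rewrite normrZ; apply: le_trans (_ : `|a - ratr r| * 1 <= _).
  rewrite ler_wpM2l//; apply: le_trans (Nd n).
  exact: (norm_le_supnorm lf).
by rewrite mulr1 ltW.
Qed.

Lemma separable_of_dense_image : separable X.
Proof.
exists (range ratcomb).
  exact: (sub_countable (card_image_le _ _) (countableP _)).
move=> O [x Ox] oO.
have /nbhs_normP[r /= r0 rO] : \forall z \near x, O z by exact: open_nbhs_nbhs.
have r2 : 0 < r / 2 by rewrite divr_gt0.
have [_ [u su <-] xu] : exists2 t, [set `|x - u| | u in seq_span] t & t < 0 + r / 2.
  apply: inf_lt; first exact: (rho_inf x).1.
  by rewrite add0r; apply: le_lt_trans (seq_span_dist0 x) _.
have [q qP] := ratcomb_dense su r2.
exists (ratcomb q); split; last by exists q.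
apply: rO => /=; rewrite add0r in xu.
by apply: le_lt_trans (ler_distD u _ _) _; rewrite [r]splitr ltrD.
Qed.

End Separability.

(** * Renorming *)

Record equiv_norm (R : realType) (V : completeNormedModType R) := EquivNorm {
  enorm : V -> R;
  enorm_bound : R;
  enormD : forall x y, enorm (x + y) <= enorm x + enorm y;
  enormZ : forall (a : R) x, enorm (a *: x) = `|a| * enorm x;
  enorm_eq0 : forall x, enorm x = 0 -> x = 0;
  enorm_ge : forall x, `|x| <= enorm x;
  enorm_le : forall x, enorm x <= enorm_bound * `|x| }.

(** The alias carries the norm N as a parameter, so that its normed structure
does not conflict with that of V. *)
Definition renormed (R : realType) (V : completeNormedModType R)
  (N : equiv_norm V) : Type := V.

Section Renormed.
Variables (R : realType) (V : completeNormedModType R) (N : equiv_norm V).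

HB.instance Definition _ := GRing.Lmodule.on (renormed N).
HB.instance Definition _ := @Lmodule_isNormed.Build R (renormed N)
  (@enorm R V N) (@enormD R V N) (@enormZ R V N) (@enorm_eq0 R V N).

Lemma renormed_complete (F : set_system (renormed N)) :
  ProperFilter F -> cauchy F -> cvg F.
Proof.
move=> FF /cauchyP cF.
have cF' : cauchy (F : set_system V).
  apply/cauchyP => e e0; have [x Fx] := cF e e0; exists x.
  apply: filterS Fx => z; rewrite -!ball_normE /=; apply: le_lt_trans.
  exact: enorm_ge.
have /cauchy_cvg/cvg_ex[l Fl] := cF'.
apply/cvg_ex; exists (l : renormed N).
apply/cvgrPdist_lt => e e0.
have B1 : 0 < `|enorm_bound N| + 1 by rewrite ltr_wpDl.
have eB : 0 < e / (`|enorm_bound N| + 1) by rewrite divr_gt0.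
move/cvgrPdist_lt: Fl => /(_ _ eB); apply: filterS => z.
rewrite ltr_pdivlMr// => /(le_lt_trans _); apply.
apply: le_trans (enorm_le N _) _; rewrite mulrC ler_wpM2l//.
by apply: le_trans (ler_norm _) _; rewrite lerDl.
Qed.

HB.instance Definition _ := Uniform_isComplete.Build (renormed N) renormed_complete.

Definition renormed_complete_type : completeNormedModType R := renormed N.

Definition to_renormed (x : V) : renormed N := x.
Definition of_renormed (x : renormed N) : V := x.

Lemma to_renormed_linear : linear to_renormed. Proof. by []. Qed.
Lemma of_renormed_linear : linear of_renormed. Proof. by []. Qed.

HB.instance Definition _ := GRing.isLinear.Build R V (renormed N) *:%R
  to_renormed to_renormed_linear.
HB.instance Definition _ := GRing.isLinear.Build R (renormed N) V *:%R
  of_renormed of_renormed_linear.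

Lemma renormed_isomorphic : isomorphic V (renormed N).
Proof.
exists to_renormed, of_renormed; split=> //.
- apply: (@lipschitz_cont R V (renormed N) to_renormed (enorm_bound N)) => x z.
  exact: enorm_le.
- apply: (@lipschitz_cont R (renormed N) V of_renormed 1) => x z.
  by rewrite mul1r; exact: enorm_ge.
Qed.

Lemma renormed_polyhedral :
  (forall F : set V, finite_dim_subspace F -> finitely_normed F (enorm N)) ->
  polyhedral (renormed N).
Proof.
move=> NF F fF.
apply: (@finitely_normed_polytope R V F (enorm N)) => //; first exact: NF.
move=> v _ v0; apply: lt_le_trans (enorm_ge N v).
by rewrite normr_gt0.
Qed.

End Renormed.

Lemma linear_bound (R : realType) (V W : normedModType R) (f : {linear V -> W}) :
  bounded_near f (nbhs (0 : V)) ->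
  exists2 K : R, 0 <= K & forall x, `|f x| <= K * `|x|.
Proof.
move=> /linear_boundedP[K [_ KP]]; exists (`|K| + 1); first by rewrite addr_ge0.
by apply: KP; rewrite (le_lt_trans (ler_norm _))// ltrDl.
Qed.

Lemma dual_sphere_le (R : realType) (V : normedModType R) (f : {linear V -> R^o}) :
  dual_sphere f -> forall x, `|f x : R| <= `|x|.
Proof.
move=> [/linear_bounded_continuous/linear_bound[K K0 fK] f1] x.
have [->|x0] := eqVneq x 0; first by rewrite linear0 !normr0.
have nx : 0 < `|x| by rewrite normr_gt0.
suff : `|f (`|x|^-1 *: x) : R| <= 1.
  by rewrite linearZR normrM normfV normr_id ler_pdivrMl// mulr1.
rewrite -f1; apply: ub_le_sup; last first.
  by exists (`|x|^-1 *: x) => //=; rewrite normrZ normfV normr_id mulVf ?gt_eqF.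
exists K => _ [z /= z1 <-]; apply: le_trans (fK z) _.
by rewrite ler_piMr.
Qed.

(** * The theorem *)

Theorem theorem1p1 (R : realType) (X Y : completeNormedModType R)
    (sepY : separable Y) (polyY : polyhedral Y)
    (T : {linear X -> Y}) (bndT : bounded_near T (nbhs (0 : X)))
    (B : set {linear X -> R^o}) (bdB : boundary B)
    (subB : B `<=` [set adjoint T g | g in @dual R Y]) :
  separable X /\
  exists Z : completeNormedModType R, polyhedral Z /\ isomorphic X Z.
Proof.
have [K K0 TK] := linear_bound bndT.
have [y y_dense] := separable_dense_seq sepY.
have /choice[f fP] : forall i, exists f : {linear Y -> R^o},
    (forall x, f x <= `|x|) /\ f (y i) = `|y i|.
  by move=> i; exact: hahn_banach_point (norm_sublinear Y).
have f_bd := dense_norming_boundary polyY y_dense (fun i => (fP i).1) (fun i => (fP i).2).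
have [s sP] := dual_cover (fun i => (fP i).1) f_bd.
have s_cover g : contracting T g ->
    exists l, forall v, `|(g v : R) - s l v| <= 2 * `|v|.
  by move=> [[C gC] _]; exact: sP gC.
have bd x : exists2 g, contracting T g & g (T x) = `|x|.
  have [h Bh hx] := bdB.2 x; have [g cg gh] := subB h Bh.
  exists g; last by rewrite -hx -gh.
  split.
    have [C _ gC] := linear_bound ((linear_bounded_continuous g).2 cg).
    by exists C.
  by move=> u; have := dual_sphere_le (bdB.1 h Bh) u; rewrite -gh.
have [M [d [d_contr d_net]]] := nets_exist y s_cover.
pose p := piece T y M d.
have pD i u v : p i (u + v) <= p i u + p i v by exact: pieceD.
have pZ i a u : p i (a *: u) = `|a| * p i u by exact: pieceZ.
have pC i u : p i u <= 2 * (1 + 4 * K) * `|u| by exact: piece_le.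
have plim u (e : R) : 0 < e ->
    exists L, forall i, (L <= i)%N -> p i u <= `|u| + e.
  exact: piece_lim.
have pgt u : u != 0 -> exists i, `|u| < p i u.
  by apply: piece_gt; [exact: bd|exact: d_net].
have lf : locally_finite p (2 * (1 + 4 * K)) by split.
pose N := @EquivNorm R X (supnorm p) (2 * (1 + 4 * K)) (supnormD lf)
  (supnormZ lf) (fun x => supnorm_eq0 lf (x := x))
  (norm_le_supnorm lf) (supnorm_le_norm lf).
split; last first.
  exists (renormed_complete_type N); split; last exact: renormed_isomorphic.
  apply: renormed_polyhedral => F fF.
  apply: (supnorm_finitely_normed lf fF) => l.
  exact: piece_finitely_normed.
have pT i : exists C : R, forall u, p i u <= C * `|T u| by exact: piece_le_image.
have [e [Ne e_dense]] := dense_preimages T lf y_dense.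
exact: (separable_of_dense_image lf pT Ne e_dense).
Qed.
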